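(* Let $k$ be an algebraically closed field of characteristic zero and $q\in k$ with $q^i\neq1$ for every nonzero integer $i$. Let $(\partial_t,\partial_x)$ be one of the pairs $(D_t,\Delta_x)$, $(D_t,\Delta_{q,x})$, $(S_t,D_x)$, $(S_t,\Delta_{q,x})$, $(Q_t,D_x)$, $(Q_t,\Delta_x)$, and let $L\in k(t)\langle\partial_t\rangle$ be nonzero. Then there exists $f\in k(t,x)$ with $f\notin\partial_x(k(t,x))$ such that $L(f)=\partial_x(g)$ for some $g\in k(t,x)$ if and only if the equation $L(y)=0$ has a nonzero solution $y\in k(t)$.
   Context: On $k(t,x)$: $D_t,D_x$ are partial derivations; $S_t(h(t,x))=h(t+1,x)$, $S_x(h(t,x))=h(t,x+1)$, $Q_t(h(t,x))=h(qt,x)$, $Q_x(h(t,x))=h(t,qx)$, $\Delta_x=S_x-1$, $\Delta_{q,x}=Q_x-1$. $k(t)\langle\partial_t\rangle$ is the ring of operators $\sum_\ell e_\ell\partial_t^\ell$ with $e_\ell\in k(t)$, acting on $k(t,x)$ (and on $k(t)$). *)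

(* Defs.v *)
From HB Require Import structures.
From mathcomp Require Import all_boot all_order all_algebra.
From mathcomp Require Import ring.

Set Implicit Arguments.
Unset Strict Implicit.
Unset Printing Implicit Defensive.

Import GRing.Theory.
Local Open Scope ring_scope.
Local Open Scope quotient_scope.

Notation "x %:F" := (@FracField.tofrac _ x) : ring_scope.

(* [fracmap s (n / d) = s n / s d], for [s] an injective ring endomorphism. *)
Definition fracmap (R : idomainType) (s : R -> R) (f : {fraction R}) :
    {fraction R} :=
  (s \n_(repr f))%:F / (s \d_(repr f))%:F.

(* [fracder D (n / d) = (D n * d - n * D d) / d ^ 2], for [D] a derivation. *)
Definition fracder (R : idomainType) (D : R -> R) (f : {fraction R}) :
    {fraction R} :=
  let n := \n_(repr f) in let d := \d_(repr f) in
  (D n * d - n * D d)%:F / (d ^+ 2)%:F.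

Section Representatives.
Variable R : idomainType.

Lemma frac_reprE (f : {fraction R}) :
  f = (\n_(repr f))%:F / (\d_(repr f))%:F.
Proof.
have dN0 : (\d_(repr f))%:F != 0 by rewrite tofrac_eq0 denom_ratioP.
apply: (mulIf dN0); rewrite divfK // -{1}[f]reprK.
unlock FracField.tofrac; rewrite -[LHS]FracField.pi_mul.
apply/eqmodP; rewrite /= FracField.equivfE /FracField.mulf.
by rewrite !numden_Ratio ?mulr1 ?mul1r ?oner_neq0 ?denom_ratioP // mulrC.
Qed.

Lemma frac_repr_cross (n d : R) : d != 0 ->
  \n_(repr (n%:F / d%:F)) * d = n * \d_(repr (n%:F / d%:F)).
Proof.
move=> dN0; apply/eqP; rewrite -tofrac_eq !rmorphM /=.
by rewrite -eqr_div ?tofrac_eq0 ?denom_ratioP // -frac_reprE.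
Qed.

Lemma fracmapE (s : {rmorphism R -> R}) (n d : R) : injective s -> d != 0 ->
  fracmap s (n%:F / d%:F) = (s n)%:F / (s d)%:F.
Proof.
move=> s_inj dN0; rewrite /fracmap; apply/eqP.
have sN0 x : x != 0 -> (s x)%:F != 0.
  by rewrite tofrac_eq0 (raddf_eq0 _ s_inj).
rewrite eqr_div ?sN0 ?denom_ratioP // -!rmorphM /= tofrac_eq.
by rewrite frac_repr_cross.
Qed.

Lemma fracderE (D : R -> R) (n d : R) :
    (forall a b, D (a * b) = D a * b + a * D b) -> d != 0 ->
  fracder D (n%:F / d%:F) = (D n * d - n * D d)%:F / (d ^+ 2)%:F.
Proof.
move=> DM dN0; rewrite /fracder; move: (frac_repr_cross n dN0).
have := denom_ratioP (repr (n%:F / d%:F)).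
move: (\n_(repr _)) (\d_(repr _)) => n' d' d'N0 e; apply/eqP.
rewrite eqr_div ?tofrac_eq0 ?expf_neq0 // -!rmorphM /= tofrac_eq.
have De : D n' * d + n' * D d = D n * d' + n * D d' by rewrite -!DM e.
rewrite -subr_eq0; apply/eqP.
have -> : (D n' * d' - n' * D d') * d ^+ 2 - (D n * d - n * D d) * d' ^+ 2
  = (D n' * d + n' * D d - (D n * d' + n * D d')) * (d * d')
    + (n * d' - n' * d) * (D d * d' + D d' * d) by ring.
by rewrite De e !subrr !mul0r addr0.
Qed.

End Representatives.

Notation kt k := {fraction {poly k}}.
Notation ktx k := {fraction {poly {fraction {poly k}}}}.

Section Operators.
Variables (k : fieldType) (q : k).

Definition cst_t (c : k) : kt k := (c%:P)%:F.
Definition cst_x (a : kt k) : ktx k := (a%:P)%:F.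

Inductive t_operator := D_t | S_t | Q_t.

Definition act_t (o : t_operator) : kt k -> kt k :=
  match o with
  | D_t => fracder (fun p => p^`())
  | S_t => fracmap (fun p => p \Po ('X + 1))
  | Q_t => fracmap (fun p => p \Po (q *: 'X))
  end.

(* On [k(t, x) = k(t)(x)] the operators in [t] act on the coefficients of the
   powers of [x]. *)
Definition act_tx (o : t_operator) : ktx k -> ktx k :=
  match o with
  | D_t => fracder (map_poly (act_t D_t))
  | S_t => fracmap (map_poly (act_t S_t))
  | Q_t => fracmap (map_poly (act_t Q_t))
  end.

Definition S_x : ktx k -> ktx k := fracmap (fun p => p \Po ('X + 1)).
Definition Q_x : ktx k -> ktx k := fracmap (fun p => p \Po (cst_t q *: 'X)).

Inductive x_operator := D_x | Delta_x | Delta_qx.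

Definition act_x (o : x_operator) : ktx k -> ktx k :=
  match o with
  | D_x => fracder (fun p => p^`())
  | Delta_x => fun f => S_x f - f
  | Delta_qx => fun f => Q_x f - f
  end.

Inductive mixed_pair : t_operator -> x_operator -> Prop :=
  | mixed_Dt_Deltax : mixed_pair D_t Delta_x
  | mixed_Dt_Deltaqx : mixed_pair D_t Delta_qx
  | mixed_St_Dx : mixed_pair S_t D_x
  | mixed_St_Deltaqx : mixed_pair S_t Delta_qx
  | mixed_Qt_Dx : mixed_pair Q_t D_x
  | mixed_Qt_Deltax : mixed_pair Q_t Delta_x.

(* The operator [\sum_l e_l partial_t ^ l] is encoded by the polynomial with
   coefficients [e_l]; the ring product of [{poly (kt k)}] is not the
   composition of operators, and is not used. *)
Definition op_t := {poly (kt k)}.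

Definition apply_t (o : t_operator) (L : op_t) (y : kt k) : kt k :=
  \sum_(l < size L) L`_l * iter l (act_t o) y.

Definition apply_tx (o : t_operator) (L : op_t) (f : ktx k) : ktx k :=
  \sum_(l < size L) cst_x L`_l * iter l (act_tx o) f.

End Operators.

(* Main.v *)
Require Import Defs.
From HB Require Import structures.
From mathcomp Require Import all_boot all_order all_algebra.
From mathcomp Require Import ring zify.
From Stdlib Require Import ClassicalEpsilon FunctionalExtensionality.
From Stdlib Require Import PropExtensionality.

(* Write [K = k(t)].  The idea is to find a [K]-subspace [C] of [K(x)], stable
   under [partial_t], with [K(x) = C + Im partial_x] and
   [C] meeting [Im partial_x] only in 0.  If [L f] is exact and [f] is not, then
   [f] is congruent to a nonzero [r] in [C] and [L r], being exact and in [C],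
   vanishes.  Since [partial_t] acts on the coefficients of Laurent series in
   [x], the lowest coefficient of [r] at [x = 0] is a nonzero solution in [K].
   Conversely a solution [y] gives the inexact [f = y / x] (or [f = y] for the
   [q]-difference operator).

   For [D_x], [C] consists of the proper fractions with simple poles (Hermite
   reduction).  For a difference operator with shift [tau], [C] consists of the
   proper fractions (plus constants, for the [q]-shift) whose poles lie on
   chosen representatives of the [tau]-orbits of irreducible polynomials.  For
   [C] to be stable under [sigma = S_t] or [Q_t], the representatives must be
   permuted by [sigma], which is possible as soon as [sigma ^ m p = tau ^ i p]
   forces [i = 0]; for the mixed pairs this is seen on the sum (for [tau] the
   shift) or the product (for the [q]-shift) of the roots of [p]. *)

Set Implicit Arguments.
Unset Strict Implicit.
Unset Printing Implicit Defensive.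

Import GRing.Theory.
Local Open Scope ring_scope.

(** * Operators on fraction fields *)

Section FractionOperators.
Variable R : idomainType.
Implicit Types (f g : {fraction R}) (n d : R).

Lemma fracP f : exists n d, d != 0 /\ f = n%:F / d%:F.
Proof.
exists (\n_(repr f)), (\d_(repr f)).
by split; [apply: denom_ratioP | apply: frac_reprE].
Qed.

Lemma tofrac_neq0 d : d != 0 -> d%:F != 0.
Proof. by rewrite tofrac_eq0. Qed.

Lemma tofrac_div1 n : n%:F = n%:F / (1 : R)%:F.
Proof. by rewrite rmorph1 divr1. Qed.

Lemma addf_tofrac n1 d1 n2 d2 : d1 != 0 -> d2 != 0 ->
  n1%:F / d1%:F + n2%:F / d2%:F = (n1 * d2 + n2 * d1)%:F / (d1 * d2)%:F.
Proof.
by move=> d1N0 d2N0; rewrite addf_div ?tofrac_neq0 // !rmorphD !rmorphM.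
Qed.

Lemma mulf_tofrac n1 d1 n2 d2 :
  n1%:F / d1%:F * (n2%:F / d2%:F) = (n1 * n2)%:F / (d1 * d2)%:F.
Proof. by rewrite mulf_div !rmorphM. Qed.

Lemma eq_tofrac_div n1 d1 n2 d2 : d1 != 0 -> d2 != 0 ->
  (n1%:F / d1%:F == n2%:F / d2%:F) = (n1 * d2 == n2 * d1).
Proof.
by move=> d1N0 d2N0; rewrite eqr_div ?tofrac_neq0 // -!rmorphM tofrac_eq.
Qed.

Section Endomorphism.
Variable s : {rmorphism R -> R}.
Hypothesis s_inj : injective s.

Let sN0 d : d != 0 -> s d != 0.
Proof. by rewrite (raddf_eq0 _ s_inj). Qed.

Lemma fracmap_tofrac n : fracmap s n%:F = (s n)%:F.
Proof.
by rewrite tofrac_div1 fracmapE ?oner_neq0 // rmorph1 -tofrac_div1.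
Qed.

Lemma fracmapD f g : fracmap s (f + g) = fracmap s f + fracmap s g.
Proof.
have [n [d [dN0 ->]]] := fracP f; have [m [e [eN0 ->]]] := fracP g.
rewrite addf_tofrac // !fracmapE ?mulf_neq0 // addf_tofrac ?sN0 //.
by rewrite rmorphD !rmorphM.
Qed.

Lemma fracmapM f g : fracmap s (f * g) = fracmap s f * fracmap s g.
Proof.
have [n [d [dN0 ->]]] := fracP f; have [m [e [eN0 ->]]] := fracP g.
by rewrite mulf_tofrac !fracmapE ?mulf_neq0 // mulf_tofrac !rmorphM.
Qed.

Fact fracmap_zmod_morphism : zmod_morphism (fracmap s).
Proof.
move=> f g; apply: (addIr (fracmap s g)).
by rewrite -fracmapD !subrK.
Qed.

Fact fracmap_monoid_morphism : monoid_morphism (fracmap s).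
Proof.
split; last exact: fracmapM.
by rewrite -tofrac1 fracmap_tofrac rmorph1.
Qed.

(** Carrying the proof of injectivity as an argument gives the ring morphism instances a head symbol
    from which that proof can be recovered. *)
Definition fracmap_rmorph of injective s := fracmap s.

HB.instance Definition _ := GRing.isZmodMorphism.Build _ _
  (fracmap_rmorph s_inj) fracmap_zmod_morphism.
HB.instance Definition _ := GRing.isMonoidMorphism.Build _ _
  (fracmap_rmorph s_inj) fracmap_monoid_morphism.

End Endomorphism.

Lemma fracmap_comm (s1 s2 : {rmorphism R -> R}) f :
    injective s1 -> injective s2 -> (forall a, s1 (s2 a) = s2 (s1 a)) ->
  fracmap s1 (fracmap s2 f) = fracmap s2 (fracmap s1 f).
Proof.
move=> inj1 inj2 s12; have [n [d [dN0 ->]]] := fracP f.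
by rewrite !fracmapE ?raddf_eq0 // !s12.
Qed.

Lemma fracmapK (s1 s2 : {rmorphism R -> R}) :
  cancel s1 s2 -> injective s2 -> cancel (fracmap s1) (fracmap s2).
Proof.
move=> s12 inj2 f; have [n [d [dN0 ->]]] := fracP f.
by rewrite !fracmapE ?s12 ?(raddf_eq0 _ (can_inj s12)) //; apply: can_inj s12.
Qed.

Section Derivation.
Variable D : {additive R -> R}.
Hypothesis DM : forall a b, D (a * b) = D a * b + a * D b.

Lemma derivation1 : D 1 = 0.
Proof. by apply: (addrI (D 1)); rewrite -{3}[1]mulr1 DM mulr1 mul1r addr0. Qed.

Lemma fracder_tofrac n : fracder D n%:F = (D n)%:F.
Proof.
rewrite tofrac_div1 fracderE ?oner_neq0 // derivation1 mulr0 subr0 mulr1.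
by rewrite expr1n -tofrac_div1.
Qed.

Lemma fracderD f g : fracder D (f + g) = fracder D f + fracder D g.
Proof.
have [n [d [dN0 ->]]] := fracP f; have [m [e [eN0 ->]]] := fracP g.
rewrite addf_tofrac // !fracderE ?mulf_neq0 // addf_tofrac ?expf_neq0 //.
apply/eqP; rewrite eq_tofrac_div ?mulf_neq0 ?expf_neq0 //.
by rewrite !raddfD /= !DM; apply/eqP; ring.
Qed.

Lemma fracderM f g :
  fracder D (f * g) = fracder D f * g + f * fracder D g.
Proof.
have [n [d [dN0 ->]]] := fracP f; have [m [e [eN0 ->]]] := fracP g.
rewrite mulf_tofrac !fracderE ?mulf_neq0 // !mulf_tofrac.
rewrite addf_tofrac ?mulf_neq0 ?expf_neq0 //; apply/eqP.
by rewrite eq_tofrac_div ?mulf_neq0 ?expf_neq0 // !DM; apply/eqP; ring.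
Qed.

Fact fracder_zmod_morphism : zmod_morphism (fracder D).
Proof.
move=> f g; apply: (addIr (fracder D g)).
by rewrite -fracderD !subrK.
Qed.

Definition fracder_additive of (forall a b, D (a * b) = D a * b + a * D b) :=
  fracder D.

HB.instance Definition _ := GRing.isZmodMorphism.Build _ _
  (fracder_additive DM) fracder_zmod_morphism.

Lemma fracmap_fracder_comm (s : {rmorphism R -> R}) f :
    injective s -> (forall a, s (D a) = D (s a)) ->
  fracmap s (fracder D f) = fracder D (fracmap s f).
Proof.
move=> s_inj sD; have [n [d [dN0 ->]]] := fracP f.
rewrite fracderE // !fracmapE ?expf_neq0 //.
by rewrite fracderE ?raddf_eq0 // rmorphXn rmorphB !rmorphM !sD.
Qed.

End Derivation.
End FractionOperators.

(** * Exactness tested on a complement of the image of [dx] *)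

Section ModuleCriterion.
Variable F : fieldType.
Local Notation V := {fraction {poly F}}.
Implicit Types (u v g : V) (y : F).

Definition cst (a : F) : V := (a%:P)%:F.

(** Covers both actions of [L]: [c] is the identity when [W] is [F], and the embedding [cst] when
    [W] is [V]. *)
Definition apply_op (W : pzRingType) (c : F -> W) (d : W -> W) (L : {poly F})
    (w : W) : W :=
  \sum_(l < size L) c L`_l * iter l d w.

(** A relation rather than a function, since a rational function has a value at [x = 0] only when it
    is regular there. *)
Definition value0 u y :=
  exists n d : {poly F},
    [/\ d.[0] != 0, u = n%:F / d%:F & y = n.[0] / d.[0]].

Lemma horner0_neq0 (d : {poly F}) : d.[0] != 0 -> d != 0.
Proof. by apply: contra_neq => ->; rewrite horner0. Qed.

Lemma value0_inj u y z : value0 u y -> value0 u z -> y = z.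
Proof.
move=> [n [d [d0 -> ->]]] [m [e [e0 /eqP]]].
rewrite eq_tofrac_div ?horner0_neq0 // => /eqP ne ->.
by apply/eqP; rewrite eqr_div // -!hornerM ne.
Qed.

Lemma value0_cst y : value0 (cst y) y.
Proof.
by exists y%:P, 1; rewrite !hornerE oner_neq0 -tofrac_div1 divr1.
Qed.

Lemma mul_div_mull (E : fieldType) (a b x y : E) : b != 0 ->
  a * (x / y) = b * (a * x / (b * y)).
Proof. by move=> bN0; rewrite invfM [RHS]mulrCA mulVKf // mulrA. Qed.

Lemma value0D u v y z : value0 u y -> value0 v z -> value0 (u + v) (y + z).
Proof.
move=> [n [d [d0 -> ->]]] [m [e [e0 -> ->]]].
exists (n * e + m * d), (d * e); rewrite hornerM mulf_neq0 //.
by rewrite addf_tofrac ?horner0_neq0 // addf_div // !hornerE.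
Qed.

Lemma value0M u v y z : value0 u y -> value0 v z -> value0 (u * v) (y * z).
Proof.
move=> [n [d [d0 -> ->]]] [m [e [e0 -> ->]]].
exists (n * m), (d * e); rewrite hornerM mulf_neq0 //.
by rewrite mulf_tofrac mulf_div !hornerE.
Qed.

Lemma poly_lowest_term (p : {poly F}) : p != 0 ->
  exists i p', p = 'X^i * p' /\ p'.[0] != 0.
Proof.
move=> pN0; have [n [p' p'0 ->]] := multiplicity_XsubC p 0.
exists n, p'; rewrite subr0 mulrC; split=> //.
by move: p'0; rewrite pN0 /= /root.
Qed.

(** [C] is the complement of the image of [dx]. The multiples [cst y * c] are the inexact functions
    built from solutions: [c] is [1 / x] for the derivation and the shift, and [1] for the
    [q]-shift. *)
Variables (dt : F -> F) (dtx dx : V -> V) (C : V -> Prop) (c : V).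
Hypotheses
  (dtxD : {morph dtx : u v / u + v})
  (dtxX : forall u, dtx ('X%:F * u) = 'X%:F * dtx u)
  (dtx_value0 : forall u y, value0 u y -> value0 (dtx u) (dt y))
  (dxD : {morph dx : u v / u + v})
  (dxZ : forall a u, dx (cst a * u) = cst a * dx u)
  (dtx_dx : forall u, dtx (dx u) = dx (dtx u))
  (CD : forall u v, C u -> C v -> C (u + v))
  (CZ : forall a u, C u -> C (cst a * u))
  (C_dtx : forall u, C u -> C (dtx u))
  (C_dx : forall u, C (dx u) -> dx u = 0)
  (C_reduce : forall u, exists v, C (u - dx v))
  (dtx_c : forall y, dtx (cst y * c) = cst (dt y) * c)
  (c_inexact : forall y u, cst y * c = dx u -> y = 0).

Local Notation Lx := (apply_op cst dtx).
Local Notation Lt := (apply_op id dt).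

Lemma apply_opD L : {morph Lx L : u v / u + v}.
Proof.
move=> u v; rewrite -big_split /=; apply: eq_bigr => l _.
rewrite -mulrDr; congr (_ * _).
by elim: (nat_of_ord l) => //= m ->; rewrite dtxD.
Qed.

Lemma dx_0 : dx 0 = 0.
Proof. by apply: (addrI (dx 0)); rewrite -dxD !addr0. Qed.

Lemma apply_op_dx L u : Lx L (dx u) = dx (Lx L u).
Proof.
rewrite /apply_op (big_morph dx dxD dx_0); apply: eq_bigr => l _.
rewrite dxZ; congr (_ * _).
by elim: (nat_of_ord l) => //= m ->; rewrite dtx_dx.
Qed.

Lemma C_zero : C 0.
Proof. by have [v /(CZ 0)] := C_reduce 0; rewrite /cst rmorph0 mul0r. Qed.

Lemma C_apply_op L u : C u -> C (Lx L u).
Proof.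
move=> Cu; rewrite /apply_op; elim/big_ind: _ => [||l _]; first exact: C_zero.
  exact: CD.
by apply: CZ; elim: (nat_of_ord l) => //= m; apply: C_dtx.
Qed.

Lemma value0_apply_op L u y : value0 u y -> value0 (Lx L u) (Lt L y).
Proof.
move=> uy; rewrite /apply_op; elim/big_ind2: _ => [|*|l _].
- by have := value0_cst 0; rewrite /cst rmorph0.
- exact: value0D.
- apply: value0M; first exact: value0_cst.
  by elim: (nat_of_ord l) => //= m; apply: dtx_value0.
Qed.

Lemma apply_opX L i u : Lx L ('X%:F ^+ i * u) = 'X%:F ^+ i * Lx L u.
Proof.
rewrite /apply_op mulr_sumr; apply: eq_bigr => l _; rewrite mulrCA.
congr (_ * _); elim: (nat_of_ord l) => //= m ->.
by elim: i => [|i IHi]; rewrite ?expr0 ?mul1r // exprS -!mulrA dtxX IHi.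
Qed.

(** [L] commutes with multiplication by powers of [x], so [u] may be replaced by its part that is
    regular and nonzero at [x = 0]. Evaluating [L u = 0] there gives the equation for the lowest
    coefficient. *)
Lemma apply_op_solution L u : u != 0 -> Lx L u = 0 ->
  exists y, y != 0 /\ Lt L y = 0.
Proof.
have [n [d [dN0 ->]]] := fracP u => uN0 Lu0.
have nN0 : n != 0 by apply: contra_neq uN0 => ->; rewrite rmorph0 mul0r.
have [i [n' [nE n'0]]] := poly_lowest_term nN0.
have [j [d' [dE d'0]]] := poly_lowest_term dN0.
exists (n'.[0] / d'.[0]); split; first by rewrite mulf_neq0 ?invr_eq0.
have Xk k : ('X : {poly F})%:F ^+ k != 0.
  by rewrite expf_neq0 ?tofrac_neq0 ?polyX_eq0.
have e : 'X%:F ^+ i * (n'%:F / d'%:F) = 'X%:F ^+ j * (n%:F / d%:F).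
  rewrite nE dE !rmorphM !rmorphXn /=.
  exact: (mul_div_mull _ _ _ (Xk j)).
have Lu'0 : Lx L (n'%:F / d'%:F) = 0.
  by apply: (mulfI (Xk i)); rewrite -apply_opX e apply_opX Lu0 !mulr0.
have : value0 (n'%:F / d'%:F) (n'.[0] / d'.[0]) by exists n', d'.
move/(value0_apply_op L); rewrite Lu'0 => /value0_inj; apply.
by have := value0_cst 0; rewrite /cst rmorph0.
Qed.

Lemma apply_op_cst L y : Lx L (cst y * c) = cst (Lt L y) * c.
Proof.
have cstD : {morph cst : a b / a + b} by move=> a b; rewrite /cst !rmorphD.
have cst_0 : cst 0 = 0 by rewrite /cst rmorph0.
rewrite /apply_op (big_morph cst cstD cst_0) mulr_suml; apply: eq_bigr => l _.
rewrite /cst !rmorphM /= -/(cst _) -mulrA; congr (_ * _).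
by elim: (nat_of_ord l) => //= m ->; rewrite dtx_c.
Qed.

Theorem inexact_solution_iff L :
  (exists f, ~ (exists h, f = dx h) /\ exists g, Lx L f = dx g)
  <-> exists y, y != 0 /\ Lt L y = 0.
Proof.
split=> [[f [f_inexact [g Lf]]] | [y [yN0 Ly0]]]; last first.
  exists (cst y * c); split=> [[h /c_inexact y0]|].
    by rewrite y0 eqxx in yN0.
  by exists 0; rewrite apply_op_cst Ly0 dx_0 /cst !rmorph0 mul0r.
have [h Cr] := C_reduce f; set r := f - dx h in Cr.
have fE : f = r + dx h by rewrite subrK.
clearbody r.
apply: (@apply_op_solution L r).
  apply/eqP => r0; apply: f_inexact; exists h.
  by rewrite fE r0 add0r.
have dxN u : dx (- u) = - dx u.
  by apply: (addrI (dx u)); rewrite -dxD !subrr dx_0.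
(* [L] commutes with [dx], so [L r] differs from the exact [L f] by an exact term; it also lies in
   [C], where only 0 is exact. *)
have e : Lx L r = dx (g - Lx L h).
  by rewrite dxD dxN -Lf -apply_op_dx fE apply_opD addrK.
by rewrite e; apply: C_dx; rewrite -e; apply: C_apply_op.
Qed.

End ModuleCriterion.

(** * Poles and degree of rational functions *)

Section RationalFunctions.
Variable F : fieldType.
Local Notation V := {fraction {poly F}}.
Implicit Types (u v : V) (p a n d : {poly F}).

Lemma irreducible_dvdpM p a b : irreducible_poly p ->
  (p %| a * b) = (p %| a) || (p %| b).
Proof.
move=> p_irr; case: (boolP (p %| a)) => [pa|]; first by rewrite dvdp_mulr.
by rewrite -irreducible_poly_coprime // => /Gauss_dvdpr ->.
Qed.

Lemma irreducible_dvdpX p a e : irreducible_poly p ->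
  (p %| a ^+ e.+1) = (p %| a).
Proof.
move=> p_irr; elim: e => // e IHe.
by rewrite exprS irreducible_dvdpM // IHe orbb.
Qed.

Lemma irreducible_ndvdp1 p : irreducible_poly p -> ~~ (p %| 1).
Proof. by move=> [p_gt1 _]; rewrite dvdp1 neq_ltn p_gt1 orbT. Qed.

Lemma irreducible_dvdp_eqp p r : irreducible_poly p -> irreducible_poly r ->
  p %| r -> p %= r.
Proof. by move=> [p_gt1 _] [_]; apply; rewrite neq_ltn p_gt1 orbT. Qed.

Lemma size_irreducible_cofactor p a :
  irreducible_poly p -> a != 0 -> (size a < size (a * p)%R)%N.
Proof.
move=> p_irr aN0; rewrite size_mul ?(irredp_neq0 p_irr) //.
case: p_irr => p_gt1 _; move: aN0 p_gt1; rewrite -(size_poly_gt0 a).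
by move: (size a) (size p) => x y; lia.
Qed.

Lemma coprimep_ndvdp p n d : irreducible_poly p -> coprimep n d -> p %| d ->
  ~~ (p %| n).
Proof.
move=> p_irr nd pd; apply/negP => pn.
have := coprimep_dvdl pd (coprimep_dvdr pn nd).
by rewrite coprimepp => /eqP p1; case: p_irr; rewrite p1.
Qed.

Lemma irreducible_factor d : (1 < size d)%N ->
  exists p, irreducible_poly p /\ p %| d.
Proof.
have [m] := ubnP (size d); elim: m d => // m IHm d; rewrite ltnS => d_m d_gt1.
(* Irreducibility comes with no decision procedure here, hence the classical case split. *)
case: (classic (irreducible_poly d)) => [d_irr|d_red].
  by exists d; rewrite dvdpp.
suff [a [a_gt1 [a_d a_dvd]]] :
    exists a : {poly F}, (1 < size a)%N /\ (size a < size d)%N /\ a %| d.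
  have [p [p_irr pa]] := IHm a (leq_trans a_d d_m) a_gt1.
  by exists p; split=> //; apply: dvdp_trans a_dvd.
apply: NNPP => no_a; apply: d_red; split=> // a a_neq1 a_dvd.
have dN0 : d != 0 by rewrite -size_poly_gt0 ltnW.
rewrite -(dvdp_size_eqp a_dvd) eqn_leq dvdp_leq //= leqNgt.
apply/negP => a_d; apply: no_a; exists a; split=> //.
have : (0 < size a)%N by rewrite size_poly_gt0 (dvdpN0 a_dvd).
by case: (size a) a_neq1 => [|[]].
Qed.

Lemma irreducible_multiplicity p d : irreducible_poly p -> d != 0 ->
  exists e d', d = p ^+ e * d' /\ ~~ (p %| d').
Proof.
move=> p_irr; have [m] := ubnP (size d); elim: m d => // m IHm d.
rewrite ltnS => d_m dN0; case: (boolP (p %| d)) => [pd|pNd].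
  2: by exists 0, d; rewrite mul1r.
have [a dE] : exists a : {poly F}, d = a * p by apply/dvdpP.
have aN0 : a != 0 by apply: contra_neq dN0 => a0; rewrite dE a0 mul0r.
have a_lt_m : (size a < m)%N.
  by apply: leq_trans d_m; rewrite dE; apply: size_irreducible_cofactor.
have [e [d' [aE pNd']]] := IHm a a_lt_m aN0.
by exists e.+1, d'; rewrite dE {1}aE exprSr mulrAC.
Qed.

Lemma frac_coprimeP u :
  exists n d, [/\ d != 0, coprimep n d & u = n%:F / d%:F].
Proof.
have [n [d [dN0 ->]]] := fracP u.
have gN0 : gcdp n d != 0 by rewrite gcdp_eq0 negb_and dN0 orbT.
have nE := divpK (dvdp_gcdl n d); have dE := divpK (dvdp_gcdr n d).
have d'N0 : d %/ gcdp n d != 0.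
  by apply: contra_neq dN0 => d'0; rewrite -dE d'0 mul0r.
exists (n %/ gcdp n d), (d %/ gcdp n d); split=> //.
  by rewrite coprimep_div_gcd ?dN0 ?orbT.
apply/eqP; rewrite eq_tofrac_div // -[X in X * _ == _]nE.
by rewrite -[X in _ == _ * X]dE mulrAC mulrA.
Qed.

Lemma frac_const n d : size d = 1%N -> n%:F / d%:F = ((lead_coef d)^-1 *: n)%:F.
Proof.
move=> d1; have [c cN0 ->] := size_poly1P _ (introT eqP d1).
rewrite lead_coefC [RHS]tofrac_div1; apply/eqP.
rewrite eq_tofrac_div ?polyC_eq0 ?oner_neq0 // mulr1.
by rewrite -mul_polyC mulrAC -polyCM mulVf // mul1r.
Qed.

(** Partial fractions: a Bezout relation between the full power [p ^+ e] of an irreducible factor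
    and the cofactor [d'] splits off the part at [p], and the other summand has a smaller
    denominator. *)
Lemma partial_fraction_ind (P : V -> Prop) :
    (forall u v, P u -> P v -> P (u + v)) -> (forall a : {poly F}, P a%:F) ->
    (forall p a e, irreducible_poly p -> P (a%:F / (p ^+ e)%:F)) ->
  forall u, P u.
Proof.
move=> PD P_poly P_irr u; have [n [d [dN0 ->]]] := fracP u.
have [m] := ubnP (size d); elim: m => // m IHm in n d dN0 *.
rewrite ltnS => d_m; have [d_gt1|d_le1] := ltnP 1 (size d); last first.
  rewrite frac_const //; apply/eqP.
  by rewrite eqn_leq d_le1 size_poly_gt0.
have [p [p_irr pd]] := irreducible_factor d_gt1.
have [e [d' [dE pNd']]] := irreducible_multiplicity p_irr dN0.
have d'N0 : d' != 0 by apply: contraNneq pNd' => ->; rewrite dvdp0.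
have peN0 : p ^+ e != 0 by rewrite expf_neq0 ?irredp_neq0.
have : coprimep (p ^+ e) d'.
  by rewrite coprimep_expl // irreducible_poly_coprime.
move=> /Bezout_eq1_coprimepP[[a b] /= ab].
have -> : n%:F / d%:F = (n * b)%:F / (p ^+ e)%:F + (n * a)%:F / d'%:F.
  rewrite addf_tofrac //; apply/eqP; rewrite dE eq_tofrac_div ?mulf_neq0 //.
  by rewrite -!mulrA -mulrDr [b * _ + _]addrC ab mulr1.
apply: PD; first exact: P_irr.
apply: IHm => //; apply: leq_trans d_m; rewrite dE size_mul //.
(* [e = 0] is impossible because [p] divides [d]; for positive [e] the factor [p ^+ e] is not
   constant, so [d'] is smaller than [d]. *)
case: e dE {peN0 ab} => [dE|e _].
  by rewrite dE mul1r (negPf pNd') in pd.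
have pe1N0 : p ^+ e.+1 != 0 by rewrite expf_neq0 // irredp_neq0.
have : (size p <= size (p ^+ e.+1))%N.
  by apply: dvdp_leq pe1N0 _; rewrite exprS dvdp_mulr.
case: p_irr d'N0 => p_gt1 _; move: p_gt1; rewrite -(size_poly_gt0 d').
by move: (size p) (size d') (size (p ^+ _)) => x y z; lia.
Qed.

(** For irreducible [p] this is membership in the local ring of [F[x]] at [p]. *)
Definition regular_at p u := exists n d, ~~ (p %| d) /\ u = n%:F / d%:F.

Lemma ndvdp_neq0 p d : ~~ (p %| d) -> d != 0.
Proof. by apply: contraNneq => ->; rewrite dvdp0. Qed.

Lemma regular_at_poly p a : irreducible_poly p -> regular_at p a%:F.
Proof.
by move=> p_irr; exists a, 1; rewrite -tofrac_div1 irreducible_ndvdp1.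
Qed.

Lemma regular_atD p u v : irreducible_poly p ->
  regular_at p u -> regular_at p v -> regular_at p (u + v).
Proof.
move=> p_irr [n [d [pd ->]]] [m [e [pe ->]]].
exists (n * e + m * d), (d * e).
by rewrite irreducible_dvdpM // negb_or pd addf_tofrac ?(ndvdp_neq0 pd)
  ?(ndvdp_neq0 pe).
Qed.

Lemma regular_atM p u v : irreducible_poly p ->
  regular_at p u -> regular_at p v -> regular_at p (u * v).
Proof.
move=> p_irr [n [d [pd ->]]] [m [e [pe ->]]].
by exists (n * m), (d * e); rewrite irreducible_dvdpM // negb_or pd mulf_tofrac.
Qed.

Lemma regular_at_coprime p n d : irreducible_poly p -> d != 0 ->
  coprimep n d -> regular_at p (n%:F / d%:F) -> ~~ (p %| d).
Proof.
move=> p_irr dN0 nd [a [b [pb /eqP]]].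
rewrite eq_tofrac_div ?(ndvdp_neq0 pb) // => /eqP e; apply/negP => pd.
have : p %| n * b by rewrite e dvdp_mull.
by rewrite irreducible_dvdpM // (negPf pb) (negPf (coprimep_ndvdp p_irr nd pd)).
Qed.

(** A nonconstant reduced denominator has an irreducible factor, and the fraction is not regular at
    that factor. *)
Lemma regular_everywhere u :
    (forall p, irreducible_poly p -> regular_at p u) ->
  exists a : {poly F}, u = a%:F.
Proof.
have [n [d [dN0 nd ->]]] := frac_coprimeP u => reg.
have [/irreducible_factor[p [p_irr pd]]|d_le1] := ltnP 1 (size d).
  by have := regular_at_coprime p_irr dN0 nd (reg p p_irr); rewrite pd.
exists ((lead_coef d)^-1 *: n); rewrite frac_const //; apply/eqP.
by rewrite eqn_leq d_le1 size_poly_gt0.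
Qed.

(* [u] has degree less than [b] as a rational function; [b = 0] is the class of
   proper fractions. *)
Definition degree_lt (b : nat) u :=
  exists n d, [/\ d != 0, u = n%:F / d%:F & (size n < size d + b)%N].

Lemma degree_ltD b u v : degree_lt b u -> degree_lt b v -> degree_lt b (u + v).
Proof.
move=> [n [d [dN0 -> nd]]] [m [e [eN0 -> me]]].
exists (n * e + m * d), (d * e); rewrite mulf_neq0 // addf_tofrac //.
split=> //; rewrite size_mul //; apply: leq_ltn_trans (size_polyD _ _) _.
have := size_polyMleq n e; have := size_polyMleq m d.
move: dN0 eN0 nd me; rewrite gtn_max -!size_poly_gt0.
move: (size n) (size m) (size d) (size e) (size (n * e)) (size (m * d)).
by move=> *; lia.
Qed.

Lemma degree_lt_cstM b (c : F) u : degree_lt b u -> degree_lt b (cst c * u).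
Proof.
move=> [n [d [dN0 -> nd]]]; exists (c *: n), d; split=> //.
  by rewrite mulrA -rmorphM /= mul_polyC.
by apply: leq_ltn_trans nd; apply: size_scale_leq.
Qed.

Lemma degree_lt_poly b a : degree_lt b a%:F -> (size a <= b)%N.
Proof.
move=> [n [d [dN0 /eqP]]]; rewrite tofrac_div1 eq_tofrac_div ?oner_neq0 //.
rewrite mulr1 => /eqP <-; have [->|aN0] := eqVneq a 0.
  by rewrite size_poly0.
rewrite size_mul //; move: dN0 aN0; rewrite -!size_poly_gt0.
by move: (size a) (size d) => x y; lia.
Qed.

Lemma poly_degree_lt b a : (size a <= b)%N -> degree_lt b a%:F.
Proof.
by move=> ab; exists a, 1; rewrite oner_neq0 -tofrac_div1 size_poly1.
Qed.

Lemma degree_ltW b u : degree_lt 0 u -> degree_lt b u.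
Proof.
move=> [n [d [dN0 -> nd]]]; exists n, d; split=> //.
by rewrite addn0 in nd; apply: leq_trans nd (leq_addr _ _).
Qed.

Section PolyAutomorphism.
Variables f g : {rmorphism {poly F} -> {poly F}}.
Hypotheses (fK : cancel f g) (gK : cancel g f).
Hypothesis size_f : forall p, size (f p) = size p.

Lemma dvdp_aut p r : (f p %| f r) = (p %| r).
Proof.
apply/idP/idP => /dvdpP[a aE]; apply/dvdpP.
  by exists (g a); apply: (can_inj fK); rewrite aE rmorphM /= gK.
by exists (f a); rewrite aE rmorphM.
Qed.

Lemma irreducible_aut p : irreducible_poly p -> irreducible_poly (f p).
Proof.
move=> [p_gt1 p_min]; split=> [|a]; first by rewrite size_f.
rewrite -(gK a) size_f.
by rewrite /eqp !dvdp_aut; apply: p_min.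
Qed.

Lemma regular_at_fracmap p u : regular_at p u -> regular_at (f p) (fracmap f u).
Proof.
move=> [n [d [pd ->]]]; exists (f n), (f d); rewrite dvdp_aut.
by rewrite fracmapE ?(ndvdp_neq0 pd) //; apply: can_inj fK.
Qed.

Lemma degree_lt_fracmap b u : degree_lt b u -> degree_lt b (fracmap f u).
Proof.
move=> [n [d [dN0 -> nd]]]; exists (f n), (f d); rewrite !size_f.
rewrite -size_poly_gt0 size_f size_poly_gt0 fracmapE //; exact: can_inj fK.
Qed.

End PolyAutomorphism.

Section Derivation.
Variable D : {additive {poly F} -> {poly F}}.
Hypothesis DM : forall a b, D (a * b) = D a * b + a * D b.
Hypothesis size_D : forall p, (size (D p) <= size p)%N.

Lemma regular_at_fracder p u : irreducible_poly p ->
  regular_at p u -> regular_at p (fracder D u).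
Proof.
move=> p_irr [n [d [pd ->]]]; exists (D n * d - n * D d), (d ^+ 2).
by rewrite irreducible_dvdpX // fracderE ?(ndvdp_neq0 pd).
Qed.

Lemma degree_lt_fracder b u : degree_lt b u -> degree_lt b (fracder D u).
Proof.
move=> [n [d [dN0 -> nd]]]; exists (D n * d - n * D d), (d ^+ 2).
rewrite expf_neq0 // fracderE //; split=> //.
rewrite expr2 size_mul //; apply: leq_ltn_trans (size_polyD _ _) _.
rewrite size_polyN.
have := size_polyMleq (D n) d; have := size_polyMleq n (D d).
have := size_D n; have := size_D d.
move: dN0 nd; rewrite gtn_max -size_poly_gt0.
move: (size (D n * d)) (size (n * D d)) (size n) (size d) (size (D n)).
move: (size (D d)).
by move=> *; lia.
Qed.

End Derivation.
End RationalFunctions.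

(** * Reduction modulo differences *)

(* Chooses an origin in each orbit of the joint action of [T] and [s]; freeness
   makes the offset from the origin well defined. *)
Lemma orbit_offset (X : Type) (w0 : X) (T : int -> X -> X)
    (s : X -> X) (P : X -> Prop) :
    (forall w, T 0 w = w) -> (forall i j w, T (i + j) w = T i (T j w)) ->
    (forall i w, s (T i w) = T i (s w)) ->
    (forall w, P w -> P (T 1 w)) -> (forall w, P w -> P (s w)) ->
    (forall m n i w, P w -> iter m s w = T i (iter n s w) -> i = 0) ->
  exists offset : X -> int,
    (forall w, P w -> offset (T 1 w) = offset w + 1) /\
    (forall w, P w -> offset (s w) = offset w).
Proof.
move=> T0 TD sT PT Ps T_free.
(* As [s] need not be invertible, forward iterates are taken on both sides to obtain an equivalence
   relation graded by the offset [i]. *)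
pose lnk i w w' := exists m n, iter m s w = T i (iter n s w').
have sTm m i w : iter m s (T i w) = T i (iter m s w).
  by elim: m => //= m ->; rewrite sT.
have T_inj i w w' : T i w = T i w' -> w = w'.
  by move=> e; rewrite -[w]T0 -[w']T0 -(addNr i) !TD e.
have lnk_refl w : lnk 0 w w by exists 0, 0; rewrite T0.
have lnk_trans i j w1 w2 w3 : lnk i w1 w2 -> lnk j w2 w3 -> lnk (i + j) w1 w3.
  move=> [m [n e1]] [m' [n' e2]]; exists (m' + m), (n + n').
  by rewrite !iterD e1 sTm -iterD addnC iterD e2 sTm TD.
have lnk_sym i w1 w2 : lnk i w1 w2 -> lnk (- i) w2 w1.
  by move=> [m [n e]]; exists n, m; rewrite e -TD addNr T0.
have lnk_uniq i w : P w -> lnk i w w -> i = 0.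
  by move=> Pw [m [n e]]; apply: T_free Pw e.
pose rep w := epsilon (inhabits w0) (fun w' => exists i, lnk i w w').
pose offset w := epsilon (inhabits 0) (fun i => lnk i w (rep w)).
have offsetP w : lnk (offset w) w (rep w).
  apply: (epsilon_spec (inhabits 0) (fun i => lnk i w (rep w))).
  apply: (epsilon_spec (inhabits w0) (fun w' => exists i, lnk i w w')).
  by exists w, 0.
(* Linked points have extensionally equal classes, so [epsilon] chooses the same origin for both. *)
have rep_lnk i w w' : lnk i w w' -> rep w = rep w'.
  move=> ww'; congr (epsilon _ _).
  apply: functional_extensionality => w1; apply: propositional_extensionality.
  split=> [[j ww1]|[j w'w1]]; last by exists (i + j); apply: lnk_trans w'w1.
  by exists (- i + j); apply: lnk_trans ww1; apply: lnk_sym.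
have offset_lnk i w w' : P w -> lnk i w w' -> offset w = i + offset w'.
  move=> Pw ww'; apply/eqP; rewrite -subr_eq0; apply/eqP.
  apply: (lnk_uniq _ w Pw); apply: (lnk_trans _ _ _ _ _ (offsetP w)).
  by apply: lnk_sym; rewrite (rep_lnk _ _ _ ww');
    exact: (lnk_trans _ _ _ _ _ ww' (offsetP w')).
exists offset; split=> w Pw.
  rewrite addrC; apply: offset_lnk; first exact: PT.
  by exists 0, 0.
rewrite -[RHS]add0r; apply: offset_lnk; first exact: Ps.
by exists 0, 1; rewrite T0.
Qed.

Section DifferenceReduction.
Variable F : fieldType.
Local Notation V := {fraction {poly F}}.
Implicit Types (u v : V) (p a n d : {poly F}).

Variables (tau taui : {rmorphism {poly F} -> {poly F}}).
Hypotheses (tauK : cancel tau taui) (tauiK : cancel taui tau).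
Hypothesis size_tau : forall p, size (tau p) = size p.

(* [special p] holds for the irreducible polynomials fixed by [tau] up to a
   constant factor; on the others [delta] locates [p] in its [tau]-orbit. *)
Variables (special : {poly F} -> Prop) (delta : {poly F} -> int) (b : nat).
Hypotheses
  (special_eqp : forall p a, p %= a -> special p -> special a)
  (special_tau : forall p, irreducible_poly p -> special (tau p) <-> special p)
  (delta_eqp : forall p a, irreducible_poly p -> p %= a -> delta p = delta a)
  (delta_tau : forall p, irreducible_poly p -> ~ special p ->
     delta (tau p) = delta p + 1).

Definition difference u := fracmap tau u - u.

(** The permitted poles are thus the ordinary irreducibles with [delta p = 0], one place in each
    [tau]-orbit. *)
Definition forbidden_pole p := special p \/ delta p != 0.

(** The bound [b = 0] leaves only proper fractions; [b = 1] also admits constants, which the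
    [q]-difference cannot remove. *)
Definition difference_normal u :=
  degree_lt b u /\
  (forall p, irreducible_poly p -> forbidden_pole p -> regular_at p u).

Let tau_inj : injective tau := can_inj tauK.

Lemma size_taui p : size (taui p) = size p.
Proof. by rewrite -[in RHS](tauiK p) size_tau. Qed.

Lemma differenceD : {morph difference : u v / u + v}.
Proof. by move=> u v; rewrite /difference fracmapD //; ring. Qed.

Lemma differenceN : {morph difference : u / - u}.
Proof.
move=> u; apply: (addIr (difference u)); rewrite -differenceD !addNr.
by rewrite /difference -tofrac0 fracmap_tofrac // rmorph0 subrr.
Qed.

Lemma differenceZ (c : F) u : tau c%:P = c%:P ->
  difference (cst c * u) = cst c * difference u.
Proof.
by move=> tau_c; rewrite /difference fracmapM ?fracmap_tofrac // tau_c mulrBr.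
Qed.

Lemma difference_normalD u v : difference_normal u -> difference_normal v ->
  difference_normal (u + v).
Proof.
move=> [u_deg u_reg] [v_deg v_reg]; split=> [|p p_irr p_bad].
  exact: degree_ltD.
by apply: regular_atD => //; [apply: u_reg | apply: v_reg].
Qed.

Lemma difference_normalZ (c : F) u :
  difference_normal u -> difference_normal (cst c * u).
Proof.
move=> [u_deg u_reg]; split=> [|p p_irr p_bad]; first exact: degree_lt_cstM.
by apply: regular_atM => //; [apply: regular_at_poly | apply: u_reg].
Qed.

(** The poles of [fracmap s u] are the images under [s] of those of [u], and the last condition on
    [s] says that it sends permitted poles to permitted poles. *)
Lemma difference_normal_fracmap (s si : {rmorphism {poly F} -> {poly F}}) u :
    cancel s si -> cancel si s -> (forall p, size (s p) = size p) ->
    (forall p, irreducible_poly p ->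
       forbidden_pole (s p) -> forbidden_pole p) ->
  difference_normal u -> difference_normal (fracmap s u).
Proof.
move=> sK siK size_s s_bad [u_deg u_reg].
split=> [|p p_irr p_bad]; first exact: (degree_lt_fracmap sK size_s).
have size_si r : size (si r) = size r by rewrite -[in RHS](siK r) size_s.
have sip_irr := irreducible_aut siK sK size_si p_irr.
rewrite -[p]siK; apply: (regular_at_fracmap sK siK); apply: u_reg => //.
by apply: s_bad; rewrite ?siK.
Qed.

Lemma difference_normal_fracder (D : {additive {poly F} -> {poly F}}) u :
    (forall a d, D (a * d) = D a * d + a * D d) ->
    (forall p, (size (D p) <= size p)%N) ->
  difference_normal u -> difference_normal (fracder D u).
Proof.
move=> DM size_D [u_deg u_reg]; split=> [|p p_irr p_bad].
  exact: degree_lt_fracder.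
by apply: regular_at_fracder => //; apply: u_reg.
Qed.

(** A polynomial has finitely many irreducible factors up to constants, and [delta] does not see
    constants. *)
Lemma delta_bound d : d != 0 ->
  exists N : nat, forall p, irreducible_poly p -> p %| d -> (`|delta p| <= N)%N.
Proof.
have [m] := ubnP (size d); elim: m d => // m IHm d; rewrite ltnS => d_m dN0.
have [/irreducible_factor[r [r_irr rd]]|d_le1] := ltnP 1 (size d); last first.
  exists 0 => p [p_gt1 _] /dvdp_leq -/(_ dN0) p_d.
  by have := leq_trans p_gt1 (leq_trans p_d d_le1).
have [a dE] : exists a : {poly F}, d = a * r by apply/dvdpP.
have aN0 : a != 0 by apply: contra_neq dN0 => a0; rewrite dE a0 mul0r.
have a_lt_m : (size a < m)%N.
  by apply: leq_trans d_m; rewrite dE; apply: size_irreducible_cofactor.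
have [N aN] := IHm a a_lt_m aN0; exists (maxn N `|delta r|) => p p_irr.
rewrite dE irreducible_dvdpM // leq_max => /orP[/(aN p p_irr) -> //|pr].
by rewrite (delta_eqp p_irr (irreducible_dvdp_eqp p_irr r_irr pr)) leqnn orbT.
Qed.

(** An ordinary pole would propagate without end. If [delta p] is nonnegative, the pole of
    [fracmap tau u] at [tau p] is forbidden in the difference and must cancel against a pole of [u]
    at [tau p]. If [delta p] is negative, the pole of [u] at [p] must cancel against one of
    [fracmap tau u], so [u] has a pole at [taui p]. Either way [delta] is unbounded on the factors
    of [d]. *)
Lemma difference_poles n d : d != 0 -> coprimep n d ->
    difference_normal (difference (n%:F / d%:F)) ->
  forall p, irreducible_poly p -> p %| d -> special p.
Proof.
move=> dN0 nd [_ reg] p0 p0_irr p0d; apply: NNPP => p0_ord.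
have tdN0 : tau d != 0 by rewrite -size_poly_gt0 size_tau size_poly_gt0.
have dxE : difference (n%:F / d%:F)
    = (tau n * d + - n * tau d)%:F / (tau d * d)%:F.
  rewrite /difference fracmapE // -addf_tofrac //.
  by rewrite [(- n)%:F]rmorphN mulNr.
(* Regularity at a forbidden [p] forces [p] to divide the numerator as soon as it divides this
   common denominator. *)
have cross p : irreducible_poly p -> forbidden_pole p ->
    p %| tau d * d -> p %| tau n * d + - n * tau d.
  move=> p_irr p_bad pdd; have [a [c [pc /eqP]]] := reg p p_irr p_bad.
  rewrite dxE eq_tofrac_div ?mulf_neq0 ?(ndvdp_neq0 pc) // => /eqP e.
  have : p %| (tau n * d + - n * tau d) * c by rewrite e dvdp_mull.
  by rewrite irreducible_dvdpM // (negPf pc) orbF.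
have [N dN] := delta_bound dN0.
have up p : irreducible_poly p -> ~ special p -> p %| d -> 0 <= delta p ->
    exists r, [/\ irreducible_poly r, ~ special r, r %| d
      & delta r = delta p + 1].
  move=> p_irr p_ord pd p_ge0.
  have tp_irr := irreducible_aut tauK tauiK size_tau p_irr.
  have tpE := delta_tau p_irr p_ord; exists (tau p); split=> //.
    by move/special_tau: p_ord; apply.
  have tp_td : tau p %| tau d by rewrite (dvdp_aut tauK tauiK).
  (* From [0 <= delta p] the value at [tau p] is at least 1, hence nonzero. *)
  have tp_bad : forbidden_pole (tau p) by right; rewrite tpE; lia.
  have := cross _ tp_irr tp_bad (dvdp_mulr _ tp_td).
  rewrite (dvdp_addl _ (dvdp_mull _ tp_td)) irreducible_dvdpM //.
  by rewrite (dvdp_aut tauK tauiK) (negPf (coprimep_ndvdp p_irr nd pd)).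
have down p : irreducible_poly p -> ~ special p -> p %| d -> delta p < 0 ->
    exists r, [/\ irreducible_poly r, ~ special r, r %| d
      & delta r = delta p - 1].
  move=> p_irr p_ord pd p_lt0.
  have tip_irr := irreducible_aut tauiK tauK size_taui p_irr.
  have tip_ord : ~ special (taui p).
    by move/(special_tau tip_irr); rewrite tauiK.
  have tipE := delta_tau tip_irr tip_ord; rewrite tauiK in tipE.
  exists (taui p); split=> //; last by rewrite tipE addrK.
  have p_bad : forbidden_pole p by right; lia.
  have := cross _ p_irr p_bad (dvdp_mull _ pd).
  rewrite (dvdp_addr _ (dvdp_mull _ pd)) irreducible_dvdpM // dvdpNr.
  rewrite (negPf (coprimep_ndvdp p_irr nd pd)) -{1}[p]tauiK.
  by rewrite (dvdp_aut tauK tauiK).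
suff /(_ N.+1)[p [p_irr _ pd]] : forall m, exists p,
    [/\ irreducible_poly p, ~ special p, p %| d & (m <= `|delta p|)%N].
  by rewrite ltnNge dN.
have [p0_ge0|p0_lt0] : 0 <= delta p0 \/ delta p0 < 0 by lia.
- suff climb m : exists p, [/\ irreducible_poly p, ~ special p, p %| d
      & (m%:Z <= delta p)].
    move=> m; have [p [p_irr p_ord pd mp]] := climb m.
    by exists p; split=> //; lia.
  elim: m => [|m [p [p_irr p_ord pd mp]]]; first by exists p0.
  have [|r [r_irr r_ord rd rE]] := up p p_irr p_ord pd; first by lia.
  by exists r; split=> //; lia.
- suff climb m : exists p, [/\ irreducible_poly p, ~ special p, p %| d
      & (delta p < - m%:Z)].
    move=> m; have [p [p_irr p_ord pd mp]] := climb m.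
    by exists p; split=> //; lia.
  elim: m => [|m [p [p_irr p_ord pd mp]]]; first by exists p0; split=> //; lia.
  have [|r [r_irr r_ord rd rE]] := down p p_irr p_ord pd; first by lia.
  by exists r; split=> //; lia.
Qed.

(** All poles of [u], and so of its image under [tau], are special, while normality excludes special
    poles from the difference. The difference is therefore regular everywhere, and the degree bound
    limits the resulting polynomial. *)
Lemma difference_normal_poly u : difference_normal (difference u) ->
  exists a, difference u = a%:F /\ (size a <= b)%N.
Proof.
move=> u_norm; have [u_deg u_reg] := u_norm.
suff [a aE] : exists a : {poly F}, difference u = a%:F.
  by exists a; split=> //; apply: degree_lt_poly; rewrite -aE.
apply: regular_everywhere => p p_irr.
case: (classic (special p)) => [p_sp|p_ord].
  by apply: u_reg => //; left.
have [n [d [dN0 nd uE]]] := frac_coprimeP u.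
rewrite uE in u_norm; have poles := difference_poles dN0 nd u_norm.
have tip_irr := irreducible_aut tauiK tauK size_taui p_irr.
rewrite uE /difference; apply: regular_atD => //.
  exists (tau n), (tau d); rewrite fracmapE //; split=> //.
  apply/negP; rewrite -{1}[p]tauiK (dvdp_aut tauK tauiK) => /(poles _ tip_irr).
  by move/(special_tau tip_irr); rewrite tauiK.
exists (- n), d; rewrite rmorphN mulNr; split=> //.
by apply/negP => /(poles _ p_irr).
Qed.

Hypothesis poly_reduce :
  forall a, exists v, difference_normal (a%:F - difference v).
Hypothesis special_reduce : forall p a e, irreducible_poly p -> special p ->
  exists v, difference_normal (a%:F / (p ^+ e)%:F - difference v).

Lemma difference_reduceD u1 u2 :
    (exists v, difference_normal (u1 - difference v)) ->
    (exists v, difference_normal (u2 - difference v)) ->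
  exists v, difference_normal (u1 + u2 - difference v).
Proof.
move=> [v1 N1] [v2 N2]; exists (v1 + v2).
by rewrite differenceD opprD addrACA; apply: difference_normalD.
Qed.

Lemma difference_reduce_exact u w :
    (exists v, difference_normal (u - difference v)) ->
  exists v, difference_normal (u + difference w - difference v).
Proof.
move=> [v Nv]; exists (v + w).
by rewrite differenceD opprD addrACA subrr addr0.
Qed.

(** Modulo differences a fraction with denominator [p ^+ e] is congruent to its images under [tau]
    and [taui], which move [delta p] by one; induction on the absolute value of [delta p] brings the
    pole to [delta p = 0]. *)
Lemma difference_reduce u : exists v, difference_normal (u - difference v).
Proof.
apply: (partial_fraction_ind
  (P := fun u => exists v, difference_normal (u - difference v)))
  => {u} [u1 u2||p a e p_irr].
- exact: difference_reduceD.
- exact: poly_reduce.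
case: (classic (special p)) => [p_sp|p_ord]; first exact: special_reduce.
have [m] := ubnP `|delta p|; elim: m => // m IHm in p a p_irr p_ord *.
rewrite ltnS => p_m.
have pN0 := irredp_neq0 p_irr.
have [p_neg|[p_pos|p0]] : delta p < 0 \/ 0 < delta p \/ delta p = 0 by lia.
- have tp_irr := irreducible_aut tauK tauiK size_tau p_irr.
  have tp_ord : ~ special (tau p) by move/(special_tau p_irr).
  have tpE := delta_tau p_irr p_ord.
  have -> : a%:F / (p ^+ e)%:F
      = (tau a)%:F / (tau p ^+ e)%:F + difference (- (a%:F / (p ^+ e)%:F)).
    rewrite differenceN /difference opprB fracmapE ?expf_neq0 // (rmorphXn tau).
    by rewrite addrC subrK.
  by apply/difference_reduce_exact/IHm => //; lia.
- have tip_irr := irreducible_aut tauiK tauK size_taui p_irr.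
  have tip_ord : ~ special (taui p).
    by move/(special_tau tip_irr); rewrite tauiK.
  have := delta_tau tip_irr tip_ord; rewrite tauiK => tipE.
  have -> : a%:F / (p ^+ e)%:F = (taui a)%:F / (taui p ^+ e)%:F
      + difference ((taui a)%:F / (taui p ^+ e)%:F).
    rewrite /difference fracmapE ?expf_neq0 ?irredp_neq0 //.
    by rewrite (rmorphXn tau) !tauiK addrC subrK.
  by apply/difference_reduce_exact/IHm => //; lia.
(* Here [delta p = 0]: once the polynomial part is split off, the proper remainder is already
   normal, so its witness is 0. *)
have peN0 : p ^+ e != 0 by rewrite expf_neq0.
have -> : a%:F / (p ^+ e)%:F
    = (a %/ p ^+ e)%:F + (a %% p ^+ e)%:F / (p ^+ e)%:F.
  by rewrite {1}(divp_eq a (p ^+ e)) rmorphD rmorphM mulrDl mulfK ?tofrac_neq0.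
apply: difference_reduceD; first exact: poly_reduce.
exists 0; rewrite /difference -tofrac0 fracmap_tofrac // rmorph0 !subrr subr0.
split=> [|r r_irr r_bad].
  apply: degree_ltW; exists (a %% p ^+ e), (p ^+ e).
  by rewrite addn0 ltn_modp.
exists (a %% p ^+ e), (p ^+ e); split=> //; apply/negP => r_pe.
have rp : r %= p.
  apply: irreducible_dvdp_eqp => //; case: (e) r_pe => [|e'].
    by rewrite (negPf (irreducible_ndvdp1 r_irr)).
  by rewrite irreducible_dvdpX.
case: r_bad => [/(special_eqp rp)//|].
by rewrite (delta_eqp r_irr rp) p0 eqxx.
Qed.
End DifferenceReduction.

(** * Hermite reduction *)

Section HermiteReduction.
Variable F : fieldType.
Hypothesis char_F : [pchar F] =i pred0.
Local Notation V := {fraction {poly F}}.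
Implicit Types (u v : V) (p a n d : {poly F}).

Lemma natr_neq0 m : (m.+1%:R : F) != 0.
Proof. by rewrite ((pcharf0P F).1 char_F). Qed.

Lemma deriv_primitive a : exists b : {poly F}, b^`() = a.
Proof.
(* Termwise integration; at [i = 0] the convention that division by 0 yields 0 makes the constant
   term vanish. *)
exists (\poly_(i < (size a).+1) (a`_i.-1 / i%:R)); apply/polyP => i.
rewrite coef_deriv coef_poly ltnS; case: ltnP => [_|/leq_sizeP -> //].
  by rewrite -[LHS]mulr_natr divfK ?natr_neq0.
by rewrite mul0rn.
Qed.

Lemma deriv_eq0 a : a^`() = 0 -> (size a <= 1)%N.
Proof.
move=> a0; apply/leq_sizeP => -[//|i] _.
have /eqP : a^`()`_i = 0 by rewrite a0 coef0.
by rewrite coef_deriv -mulr_natr mulf_eq0 (negPf (natr_neq0 _)) orbF => /eqP.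
Qed.

(** Separability in characteristic zero: the derivative is nonzero and of smaller degree than
    [p]. *)
Lemma irreducible_ndvdp_deriv p : irreducible_poly p -> ~~ (p %| p^`()).
Proof.
move=> [p_gt1 _]; apply/negP => /dvdp_leq p_dvd.
have dpN0 : p^`() != 0.
  by apply: contraTneq p_gt1 => /deriv_eq0; rewrite -leqNgt.
have := lt_size_deriv (_ : p != 0); rewrite -size_poly_gt0 ltnW // => /(_ isT).
by rewrite ltnNge p_dvd.
Qed.

Definition fracderiv u := fracder (fun p => p^`()) u.

Definition simple_poles u :=
  degree_lt 0 u /\ (forall p, irreducible_poly p -> regular_at p (p%:F * u)).

Lemma fracderivD : {morph fracderiv : u v / u + v}.
Proof. exact: (fracderD (D := @deriv F) (@derivM F)). Qed.

Lemma simple_polesD u v : simple_poles u -> simple_poles v ->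
  simple_poles (u + v).
Proof.
move=> [u_deg u_reg] [v_deg v_reg]; split=> [|p p_irr].
  exact: degree_ltD.
by rewrite mulrDr; apply: regular_atD => //; [apply: u_reg | apply: v_reg].
Qed.

Lemma simple_polesZ (c : F) u : simple_poles u -> simple_poles (cst c * u).
Proof.
move=> [u_deg u_reg]; split=> [|p p_irr]; first exact: degree_lt_cstM.
rewrite mulrCA; apply: regular_atM => //; last exact: u_reg.
exact: regular_at_poly.
Qed.

Lemma simple_poles_fracmap (s si : {rmorphism {poly F} -> {poly F}}) u :
    cancel s si -> cancel si s -> (forall p, size (s p) = size p) ->
  simple_poles u -> simple_poles (fracmap s u).
Proof.
move=> sK siK size_s [u_deg u_reg].
split=> [|p p_irr]; first exact: (degree_lt_fracmap sK size_s).
have size_si r : size (si r) = size r by rewrite -[in RHS](siK r) size_s.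
have sip_irr := irreducible_aut siK sK size_si p_irr.
have := regular_at_fracmap sK siK (u_reg _ sip_irr).
by rewrite fracmapM ?fracmap_tofrac ?siK //; apply: can_inj sK.
Qed.

(** In characteristic zero differentiation raises the order of every pole by one, to at least 2. So
    [u] has no pole, its derivative is a polynomial, and the only proper polynomial is 0. *)
Lemma simple_poles_fracderiv u : simple_poles (fracderiv u) -> fracderiv u = 0.
Proof.
have [n [d [dN0 nd ->]]] := frac_coprimeP u => -[u_deg u_reg].
suff [a uE] : exists a : {poly F}, n%:F / d%:F = a%:F.
  move: u_deg; rewrite uE /fracderiv.
  rewrite (fracder_tofrac (D := @deriv F) (@derivM F)).
  move=> /degree_lt_poly; rewrite leqn0 size_poly_eq0 => /eqP ->.
  exact: rmorph0.
apply: regular_everywhere => p p_irr; exists n, d; split=> //.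
have [[|e] [c [dE pc]]] := irreducible_multiplicity p_irr dN0.
  by rewrite dE mul1r.
have pd : p %| d by rewrite dE exprS -mulrA dvdp_mulr.
have pn := coprimep_ndvdp p_irr nd pd.
have [x [y [py]]] := u_reg p p_irr.
rewrite /fracderiv (fracderE (D := @deriv F) _ (@derivM F) dN0) mulrA.
rewrite -rmorphM /=.
move=> /eqP; rewrite eq_tofrac_div ?expf_neq0 ?(ndvdp_neq0 py) // => /eqP.
set Q := p ^+ e; have dE' : d = p * Q * c by rewrite dE exprS.
have QN0 : Q != 0 by rewrite expf_neq0 // irredp_neq0.
have ddE : d^`() = e.+1%:R * (p^`() * Q * c) + p * Q * c^`().
  rewrite dE derivM deriv_exp /= -/Q -mulr_natl exprS -/Q; ring.
rewrite ddE dE' => E.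
have {E} E : p * (n^`() * c - n * c^`()) * y - x * p * Q * c ^+ 2
    = e.+1%:R * (n * p^`() * c * y).
  apply: (mulfI (mulf_neq0 (irredp_neq0 p_irr) QN0)); apply/eqP.
  rewrite -subr_eq0 -(subrr (x * (p * Q * c) ^+ 2)) -{1}E; apply/eqP; ring.
have : p %| e.+1%:R * (n * p^`() * c * y).
  rewrite -E; apply: dvdp_sub; rewrite -!mulrA; first exact: dvdp_mulr.
  by rewrite mulrCA; apply: dvdp_mulr.
rewrite -polyC_natr mul_polyC dvdpZr ?natr_neq0 // !irreducible_dvdpM //.
rewrite (negPf pn) (negPf pc) (negPf py).
by rewrite (negPf (irreducible_ndvdp_deriv p_irr)).
Qed.

(** Polynomials are derivatives, and integration by parts lowers the exponent of each denominator
    [p ^+ e] until it is 1. *)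
Lemma simple_poles_reduce u : exists v, simple_poles (u - fracderiv v).
Proof.
pose P u := exists v, simple_poles (u - fracderiv v).
have PD u1 u2 : P u1 -> P u2 -> P (u1 + u2).
  move=> [v1 N1] [v2 N2]; exists (v1 + v2).
  by rewrite fracderivD opprD addrACA; apply: simple_polesD.
have simple_poles0 : simple_poles 0.
  split=> [|p p_irr]; last by rewrite mulr0 -tofrac0; apply: regular_at_poly.
  by rewrite -tofrac0; apply: poly_degree_lt; rewrite size_poly0.
have P_exact v : P (fracderiv v) by exists v; rewrite subrr.
have P_poly a : P a%:F.
  have [b <-] := deriv_primitive a.
  by rewrite -(fracder_tofrac (D := @deriv F) (@derivM F)); apply: P_exact.
apply: (partial_fraction_ind (P := P)) => // {u} p a e p_irr.
have pN0 := irredp_neq0 p_irr.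
elim: e a => [|[|e] IHe] a.
- by rewrite expr0 -tofrac_div1.
- have -> : a%:F / (p ^+ 1)%:F = (a %/ p)%:F + (a %% p)%:F / p%:F.
    rewrite {1}(divp_eq a p) expr1 rmorphD rmorphM mulrDl mulfK //.
    exact: tofrac_neq0.
  apply: PD => //; exists 0.
  rewrite /fracderiv -tofrac0 (fracder_tofrac (D := @deriv F) (@derivM F)) /=.
  rewrite deriv0 subr0; split=> [|r r_irr].
    by exists (a %% p), p; rewrite addn0 ltn_modp.
  case: (boolP (r %| p)) => [rp|rNp]; last first.
    by exists (r * (a %% p)), p; rewrite rmorphM mulrA.
  have /eqpf_eq[c cN0 rE] := irreducible_dvdp_eqp r_irr p_irr rp.
  exists (c *: (a %% p)), 1; rewrite irreducible_ndvdp1 // -tofrac_div1 rE.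
  split=> //; rewrite mulrA -rmorphM /= -scalerAl mulrC scalerAr rmorphM.
  rewrite mulKf //; exact: tofrac_neq0.
have /Bezout_eq1_coprimepP[[x y] /= xy] : coprimep p p^`().
  by rewrite irreducible_poly_coprime // irreducible_ndvdp_deriv.
pose w := e.+1%:R^-1 *: (a * y).
have wE : w * (e.+1%:R : {poly F}) = a * y.
  by rewrite -polyC_natr mulrC mul_polyC scalerA divff ?natr_neq0 ?scale1r.
suff -> : a%:F / (p ^+ e.+2)%:F
    = (a * x + w^`())%:F / (p ^+ e.+1)%:F
      + fracderiv ((- w)%:F / (p ^+ e.+1)%:F).
  by apply: PD; [apply: IHe | apply: P_exact].
have peN0 k : p ^+ k != 0 by rewrite expf_neq0.
rewrite /fracderiv (fracderE (D := @deriv F) _ (@derivM F) (peN0 _)).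
have sqN0 := expf_neq0 2 (peN0 e.+1); rewrite (addf_tofrac _ _ (peN0 _) sqN0).
apply/eqP; rewrite (eq_tofrac_div _ _ (peN0 _) (mulf_neq0 (peN0 _) sqN0)).
rewrite derivN deriv_exp /= -mulr_natl !exprS; set Q := p ^+ e.
apply/eqP; transitivity (a * (x * p + y * p^`()) * (p * Q) ^+ 3).
  by rewrite xy; ring.
by rewrite [a * (_ + _)]mulrDr [a * (y * _)]mulrA -wE; ring.
Qed.
End HermiteReduction.

(** * Shifts and [q]-shifts of polynomials *)

Section Shifts.
Variable F : fieldType.
Local Notation V := {fraction {poly F}}.
Implicit Types (u v : V) (p a n d : {poly F}).

Lemma comp_shiftK (c : F) :
  cancel (comp_poly ('X + c%:P)) (comp_poly ('X - c%:P)).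
Proof.
move=> p; rewrite /= -comp_polyA comp_polyD comp_polyX comp_polyC subrK.
exact: comp_polyXr.
Qed.

Lemma comp_scaleK (q : F) : q != 0 ->
  cancel (comp_poly (q *: 'X)) (comp_poly (q^-1 *: 'X)).
Proof.
move=> q0 p; rewrite /= -comp_polyA comp_polyZ comp_polyX scalerA divff //.
by rewrite scale1r comp_polyXr.
Qed.

Lemma size_comp_shift (c : F) p : size (p \Po ('X + c%:P)) = size p.
Proof. by rewrite size_comp_poly2 // size_XaddC. Qed.

Lemma size_comp_scale (q : F) p : q != 0 -> size (p \Po (q *: 'X)) = size p.
Proof. by move=> q0; rewrite size_comp_poly2 // size_scale ?size_polyX. Qed.

Lemma coef_comp_scale (q : F) p i : (p \Po (q *: 'X))`_i = q ^+ i * p`_i.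
Proof.
elim/poly_ind: p i => [|p c IHp] i; first by rewrite comp_poly0 !coef0 mulr0.
rewrite comp_polyD comp_polyM comp_polyX comp_polyC -scalerAr.
rewrite !coefD coefZ !coefMX !coefC.
case: i => [|i] /=; first by rewrite mulr0 expr0 mul1r.
by rewrite IHp !addr0 exprS mulrA.
Qed.

Lemma horner0_comp_scale (q : F) p : (p \Po (q *: 'X)).[0] = p.[0].
Proof. by rewrite !horner_coef0 coef_comp_scale mul1r. Qed.

(** These are the two top coefficients in the binomial expansion: the size bound makes [i.+1] the
    largest possible exponent. *)
Lemma coef_comp_shift p i : (size p <= i.+2)%N ->
  (p \Po ('X + 1))`_i = p`_i + i.+1%:R * p`_i.+1
  /\ (p \Po ('X + 1))`_i.+1 = p`_i.+1.
Proof.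
elim/poly_ind: p i => [|p c IHp] i.
  by rewrite comp_poly0 !coef0 mulr0 addr0.
move=> p_i.
have {p_i} p_i : (size p <= i.+1)%N.
  apply/leq_sizeP => j ij; have /leq_sizeP/(_ j.+1) := p_i.
  by rewrite coefD coefMX coefC addr0; apply.
rewrite comp_polyD comp_polyM comp_polyX comp_polyC mulrDr mulr1.
rewrite !coefD !coefMX !coefC /=.
case: i p_i => [|i] p_i /=.
  rewrite (size1_polyC p_i) comp_polyC !coefC /=.
  by split; ring.
have [e1 e2] := IHp i p_i; have /leq_sizeP p0 := p_i.
have [e3 e4] := IHp i.+1 (leqW p_i).
by rewrite e1 e2 e4 (p0 i.+2) //; split; ring.
Qed.

(** If [u] is regular at 0, the difference takes the value 0 there. If [u] has a pole of order
    [m.+1] at 0, its lowest Laurent coefficient is multiplied by [q ^- m.+1 - 1], which is nonzero,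
    so the difference keeps the pole and is not constant. *)
Lemma scale_difference_const (q : F) u (c : F) : q != 0 ->
    (forall m, q ^+ m.+1 != 1) ->
  fracmap (comp_poly (q *: 'X)) u - u = cst c -> c = 0.
Proof.
move=> qN0 q_ord; have tau_inj := can_inj (comp_scaleK qN0).
have [n [d [dN0 nd ->]]] := frac_coprimeP u.
rewrite fracmapE // -mulNr -rmorphN.
have tdN0 : comp_poly (q *: 'X) d != 0 by rewrite raddf_eq0.
rewrite addf_tofrac // /cst [RHS]tofrac_div1 => /eqP.
rewrite eq_tofrac_div ?mulf_neq0 ?oner_neq0 // mulr1 => /eqP e.
have [d0|d0] := eqVneq d.[0] 0; last first.
  move/(congr1 (horner^~ 0)): e; rewrite !hornerE !horner0_comp_scale.
  rewrite mulNr subrr => /esym/eqP; rewrite !mulf_eq0 (negPf d0) !orbF.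
  by move/eqP.
have n0 : n.[0] != 0.
  by move: nd; rewrite coprimep_sym => /coprimep_root; apply; apply/eqP.
have [[|m] [d' [dE d'0]]] := poly_lowest_term dN0.
  by case/eqP: d'0; rewrite -[RHS]d0 dE mul1r.
have tdE : comp_poly (q *: 'X) d
    = 'X^(m.+1) * (q ^+ m.+1 *: comp_poly (q *: 'X) d').
  by rewrite dE rmorphM rmorphXn /= comp_polyX exprZn -scalerAl scalerAr.
move: e; rewrite /= tdE dE => e.
(* One factor [x ^ m.+1] is cancelled; the right side still contains another, so it vanishes at
   0. *)
have {e} : comp_poly (q *: 'X) n * d'
      - n * (q ^+ m.+1 *: comp_poly (q *: 'X) d')
    = c%:P * (q ^+ m.+1 *: comp_poly (q *: 'X) d') * ('X^(m.+1) * d').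
  have XmN0 : 'X^(m.+1) != 0 :> {poly F} by rewrite expf_neq0 ?polyX_eq0.
  by apply: (mulfI XmN0); apply: etrans (etrans _ e) _; ring.
move/(congr1 (horner^~ 0)).
rewrite !(hornerM, hornerD, hornerN, hornerZ, hornerXn) !horner0_comp_scale.
rewrite expr0n /= mul0r mulr0.
have -> : n.[0] * d'.[0] - n.[0] * (q ^+ m.+1 * d'.[0])
    = n.[0] * d'.[0] * (1 - q ^+ m.+1) by ring.
move/eqP; rewrite !mulf_eq0 (negPf n0) (negPf d'0) subr_eq0 eq_sym.
by rewrite (negPf (q_ord m)).
Qed.

End Shifts.

(** * Locating irreducible polynomials in their orbits *)

Section OrbitLocation.
Variables (F : fieldType) (s : {rmorphism F -> F}).
Hypothesis char_F : [pchar F] =i pred0.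
Implicit Types (p a : {poly F}).

Lemma irreducible_size p : irreducible_poly p -> exists m, size p = m.+2.
Proof.
by move=> [p_gt1 _]; exists (size p).-2; case: (size p) p_gt1 => [|[]].
Qed.

(* Minus the mean of the roots of [p] is translated by 1. *)
Lemma shift_location :
    (forall m n i w, iter m s w = iter n s w + i%:~R -> i = 0) ->
  exists delta : {poly F} -> int,
    [/\ forall p a, irreducible_poly p -> p %= a -> delta p = delta a,
        forall p, irreducible_poly p -> delta (p \Po ('X + 1)) = delta p + 1,
        forall p, irreducible_poly p -> delta (map_poly s p) = delta p
      & delta 'X = 0].
Proof.
move=> s_free; pose T (i : int) (w : F) := w + i%:~R.
have [||||||off [offT offs]] := @orbit_offset F 0 T s (fun _ => True) => //.
- by move=> w; rewrite /T addr0.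
- by move=> i j w; rewrite /T addrAC intrD addrA.
- by move=> i w; rewrite /T rmorphD rmorph_int.
- by move=> m n i w _; apply: s_free.
pose loc p := p`_(size p).-2 / ((size p).-1%:R * p`_(size p).-1).
(* Subtracting the offset of ['X] makes ['X] the representative of its own orbit, so that [1 / x] is
   a normal fraction. *)
exists (fun p => off (loc p) - off (loc 'X)); split.
- move=> p a _ /eqpf_eq[c cN0 ->]; congr (off _ - _).
  rewrite /loc size_scale // !coefZ [_%:R * _]mulrCA.
  by rewrite -mulf_div divff // mul1r.
- move=> p /irreducible_size[m p_m]; rewrite addrAC -offT //; congr (off _ - _).
  rewrite /loc /T (size_comp_shift 1) p_m /=.
  have [-> ->] : (p \Po ('X + 1))`_m = p`_m + m.+1%:R * p`_m.+1
    /\ (p \Po ('X + 1))`_m.+1 = p`_m.+1 by apply: coef_comp_shift; rewrite p_m.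
  rewrite mulrDl divff // mulf_neq0 ?natr_neq0 //.
  have : lead_coef p != 0 by rewrite lead_coef_eq0 -size_poly_eq0 p_m.
  by rewrite lead_coefE p_m.
- move=> p _; rewrite -(offs (loc p)) //; congr (off _ - _).
  by rewrite /loc size_map_poly !coef_map fmorph_div rmorphM rmorph_nat.
- by rewrite subrr.
Qed.

(* The product of the roots of [p], up to sign, is scaled by [q ^- deg p]. *)
Lemma scale_location (q : F) : q != 0 -> s q = q ->
    (forall m n i w, w != 0 -> iter m s w = q ^ i * iter n s w -> i = 0) ->
  exists delta : {poly F} -> int,
    [/\ forall p a, irreducible_poly p -> p %= a -> delta p = delta a,
        forall p, irreducible_poly p -> ~ p %= 'X ->
          delta (p \Po (q *: 'X)) = delta p + 1
      & forall p, irreducible_poly p -> ~ p %= 'X ->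
          delta (map_poly s p) = delta p].
Proof.
move=> q0 sq s_free.
(* The first entry records the degree of the polynomial, which determines the power of [q] by which
   the second entry is scaled. *)
pose T (i : int) (w : nat * F) := (w.1, q ^ (- (i * w.1%:Z)) * w.2).
pose S (w : nat * F) := (w.1, s w.2).
(* A positive degree lets a vanishing exponent [i * w.1] force [i = 0]; a nonzero second entry means
   that [x] does not divide the polynomial. *)
pose P (w : nat * F) := (0 < w.1)%N && (w.2 != 0).
have iterS m w : iter m S w = (w.1, iter m s w.2).
  by elim: m => [|m /= ->]; [case: w | ].
have [||||||off [offT offs]] := @orbit_offset (nat * F)%type (0%N, 0) T S P.
- by move=> [n w]; rewrite /T mul0r oppr0 expr0z mul1r.
- by move=> i j [n w]; rewrite /T /= mulrA -expfzDr // mulrDl opprD.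
- by move=> i [n w]; rewrite /T /S /= rmorphM /= fmorphXz sq.
- move=> [n w] /andP[/= n0 w0]; rewrite /P /T /= n0 mulf_neq0 //.
  by rewrite expfz_neq0.
- by move=> [n w] /andP[/= n0 w0]; rewrite /P /S /= n0 fmorph_eq0.
- move=> m m' i [n w] /andP[/= n0 w0]; rewrite !iterS /T /= => -[].
  by move/(s_free _ _ _ _ w0); lia.
pose loc p := ((size p).-1, p`_0 / p`_(size p).-1).
have locP p : irreducible_poly p -> ~ p %= 'X -> P (loc p).
  move=> p_irr pX; have [m p_m] := irreducible_size p_irr.
  have lc0 : p`_m.+1 != 0.
    have : lead_coef p != 0 by rewrite lead_coef_eq0 -size_poly_eq0 p_m.
    by rewrite lead_coefE p_m.
  rewrite /P /loc p_m /= mulf_neq0 ?invr_eq0 //; apply/eqP => p0; apply: pX.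
  rewrite eqp_sym; apply: irreducible_dvdp_eqp => //.
    by rewrite -['X]addr0 -polyC0; apply: irredp_XaddC.
  by rewrite -['X]subr0 -polyC0 -root_factor_theorem /root horner_coef0 p0.
exists (fun p => off (loc p)); split.
- move=> p a _ /eqpf_eq[c cN0 ->]; congr off.
  by rewrite /loc size_scale // !coefZ -mulf_div divff // mul1r.
- move=> p p_irr pX; rewrite -offT; last exact: locP.
  congr off; rewrite /loc /T size_comp_scale // !coef_comp_scale /=.
  rewrite mul1r mul1r invfM mulrCA -exprnN; congr (_, _ * _).
- move=> p p_irr pX; rewrite -[RHS]offs; last exact: locP.
  by congr off; rewrite /loc /S size_map_poly !coef_map fmorph_div.
Qed.

End OrbitLocation.

(** * The criterion for each pair of operators *)

(** Collects what the module criterion asks of [dtx] and what automorphisms and derivations acting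
    on coefficients have in common. *)
Record coefficientwise (F : fieldType) (dt : F -> F)
    (dtx : {fraction {poly F}} -> {fraction {poly F}}) : Prop := {
  coefficientwiseD : {morph dtx : u v / u + v};
  coefficientwiseX : forall u, dtx ('X%:F * u) = 'X%:F * dtx u;
  coefficientwise_cst : forall a, dtx (cst a) = cst (dt a);
  coefficientwise_value0 :
    forall u a, value0 u a -> value0 (dtx u) (dt a)
}.

Section CoefficientMaps.
Variable F : fieldType.

Lemma polyX_fracN0 : ('X : {poly F})%:F != 0.
Proof. by rewrite tofrac_neq0 ?polyX_eq0. Qed.

Lemma coefficientwise_divX (dt : F -> F) dtx a : coefficientwise dt dtx ->
  dtx (cst a * 'X%:F^-1) = cst (dt a) * 'X%:F^-1.
Proof.
move=> H; apply: (mulfI polyX_fracN0); rewrite -(coefficientwiseX H).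
rewrite ![_ * (cst _ * _)]mulrCA divff ?polyX_fracN0 // !mulr1.
exact: coefficientwise_cst H a.
Qed.

Lemma map_poly_injective (s : {rmorphism F -> F}) : injective (map_poly s).
Proof. exact: (map_inj_poly (fmorph_inj s) (rmorph0 s)). Qed.

Lemma fracmap_coefficientwise (s : {rmorphism F -> F}) :
  coefficientwise s (fracmap (map_poly s)).
Proof.
have s_inj := @map_poly_injective s; split=> [u v|u|a|u a].
- exact: fracmapD.
- by rewrite fracmapM // fracmap_tofrac //= map_polyX.
- by rewrite /cst fracmap_tofrac //= map_polyC.
move=> [n [d [d0 -> ->]]]; exists (map_poly s n), (map_poly s d).
have mapE (p : {poly F}) : (map_poly s p).[0] = s p.[0].
  by rewrite -horner_map rmorph0.
rewrite !mapE fmorph_eq0 fmorph_div fracmapE //.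
exact: horner0_neq0.
Qed.

Section Derivation.
Variable D : {additive F -> F}.
Hypothesis DM : forall a b, D (a * b) = D a * b + a * D b.

Lemma map_poly_derivM (p r : {poly F}) :
  map_poly D (p * r) = map_poly D p * r + p * map_poly D r.
Proof.
apply/polyP => i; rewrite coefD !coef_map !coefM raddf_sum -big_split /=.
by apply: eq_bigr => j _; rewrite DM !coef_map.
Qed.

Lemma size_map_poly_deriv (p : {poly F}) : (size (map_poly D p) <= size p)%N.
Proof. exact: size_poly. Qed.

Lemma map_poly_derivX : map_poly D 'X = 0.
Proof.
apply/polyP => i; rewrite coef_map coefX coef0.
by case: (i == 1%N); rewrite ?raddf0 //= (derivation1 DM).
Qed.

Lemma map_poly_derivC a : map_poly D a%:P = (D a)%:P.
Proof. by rewrite map_polyC. Qed.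

(** The chain rule, whose inner term disappears because [D] kills the coefficients of [r]. *)
Lemma map_poly_deriv_comp (r p : {poly F}) : map_poly D r = 0 ->
  map_poly D (p \Po r) = map_poly D p \Po r.
Proof.
move=> Dr; elim/poly_ind: p => [|p c IHp]; first by rewrite comp_poly0 !raddf0.
rewrite comp_polyD comp_polyM comp_polyX comp_polyC !raddfD /=.
rewrite !map_poly_derivM IHp Dr mulr0 addr0 !map_poly_derivC map_poly_derivX.
by rewrite mulr0 addr0 comp_polyM comp_polyX comp_polyC.
Qed.

Lemma fracder_coefficientwise : coefficientwise D (fracder (map_poly D)).
Proof.
split=> [u v|u|a|u a].
- exact: (fracderD map_poly_derivM).
- rewrite (fracderM map_poly_derivM) (fracder_tofrac map_poly_derivM) /=.
  by rewrite map_poly_derivX tofrac0 mul0r add0r.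
- by rewrite /cst (fracder_tofrac map_poly_derivM) /= map_poly_derivC.
move=> [n [d [d0 -> ->]]].
exists (map_poly D n * d - n * map_poly D d), (d ^+ 2).
have dN0 := horner0_neq0 d0.
rewrite horner_exp expf_neq0 // (fracderE _ map_poly_derivM dN0); split=> //.
have mapE (p : {poly F}) : (map_poly D p).[0] = D p.[0].
  by rewrite !horner_coef0 coef_map.
rewrite hornerD hornerN !hornerM !mapE.
(* The quotient rule in [F], obtained by differentiating the product of the quotient with its
   denominator. *)
have := DM (n.[0] / d.[0]) d.[0]; rewrite divfK // => ->.
apply: (mulIf (expf_neq0 2 d0)); rewrite divfK ?expf_neq0 //.
rewrite -[X in _ - X * _](divfK d0); ring.
Qed.

End Derivation.
End CoefficientMaps.

Section Criteria.
Variable F : fieldType.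
Hypothesis char_F : [pchar F] =i pred0.
Local Notation V := {fraction {poly F}}.
Variables (dt : F -> F) (dtx : V -> V).
Hypothesis dt_dtx : coefficientwise dt dtx.

Local Notation inexact_solution dx := (forall L : {poly F},
  (exists f, ~ (exists h, f = dx h) /\
     exists g, apply_op (@cst F) dtx L f = dx g)
  <-> exists y, y != 0 /\ apply_op id dt L y = 0).

Lemma ndvdp_polyX (p : {poly F}) :
  irreducible_poly p -> ~ p %= 'X -> ~~ (p %| 'X).
Proof.
move=> p_irr pX; apply/negP => p_dvd; apply: pX.
apply: irreducible_dvdp_eqp => //.
by rewrite -['X]addr0 -polyC0; apply: irredp_XaddC.
Qed.

Lemma degree_lt_divX (a : F) : degree_lt 0 (cst a * 'X%:F^-1).
Proof.
exists a%:P, 'X; rewrite polyX_eq0 size_polyX size_polyC; split=> //.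
by case: (a == 0).
Qed.

Lemma cst_eq0 (a : F) : cst a = 0 -> a = 0.
Proof. by move/eqP; rewrite /cst tofrac_eq0 polyC_eq0 => /eqP. Qed.

Lemma cst_divX_eq0 (a : F) : cst a * 'X%:F^-1 = 0 -> a = 0.
Proof.
move/eqP; rewrite mulf_eq0 invr_eq0 (negPf (polyX_fracN0 F)) orbF.
by move/eqP/cst_eq0.
Qed.

Lemma derivation_criterion :
    (forall u, dtx (fracderiv u) = fracderiv (dtx u)) ->
    (forall u, simple_poles u -> simple_poles (dtx u)) ->
  inexact_solution (@fracderiv F).
Proof.
move=> dtx_dx sp_dtx.
apply: (inexact_solution_iff (C := @simple_poles F) (c := 'X%:F^-1)) => //.
- exact: coefficientwiseD dt_dtx.
- exact: coefficientwiseX dt_dtx.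
- exact: coefficientwise_value0 dt_dtx.
- exact: fracderivD.
- move=> a u; rewrite /fracderiv (fracderM (D := @deriv F) (@derivM F)).
  rewrite (fracder_tofrac (D := @deriv F) (@derivM F)) /=.
  by rewrite derivC tofrac0 mul0r add0r.
- exact: simple_polesD.
- exact: simple_polesZ.
- exact: simple_poles_fracderiv.
- exact: simple_poles_reduce.
- by move=> y; apply: coefficientwise_divX.
(* [y / x] has only a simple pole, so it lies in [C] and vanishes if it is exact. *)
move=> y u yE; apply: cst_divX_eq0; rewrite yE.
apply: simple_poles_fracderiv => //; rewrite -yE; split=> [|p p_irr].
  exact: degree_lt_divX.
case: (classic (p %= 'X)) => [/eqpf_eq[c cN0 pE]|pX].
  exists (c *: y%:P), 1; rewrite irreducible_ndvdp1 // -tofrac_div1 pE.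
  split=> //; rewrite -!mul_polyC !rmorphM /= [_%:P%:F * 'X%:F]mulrC.
  rewrite -mulrA [LHS]mulrC.
  by rewrite !mulrA mulfVK ?polyX_fracN0.
by exists (p * y%:P), 'X; rewrite ndvdp_polyX // rmorphM mulrA.
Qed.

Section Shift.
Variable delta : {poly F} -> int.
Hypotheses
  (delta_eqp : forall p a, irreducible_poly p -> p %= a -> delta p = delta a)
  (delta_tau : forall p, irreducible_poly p ->
    delta (p \Po ('X + 1)) = delta p + 1)
  (deltaX : delta 'X = 0).

Definition shift_tau : {rmorphism {poly F} -> {poly F}} := comp_poly ('X + 1).
(** In characteristic zero no irreducible polynomial is fixed by [x -> x + 1] up to a constant, so
    there are no special ones. *)
Definition never (p : {poly F}) := False.

Let tauK : cancel shift_tau (comp_poly ('X - 1)) := comp_shiftK 1.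
Let tauiK : cancel (comp_poly ('X - 1)) shift_tau.
Proof.
by move=> p; have := comp_shiftK (-1) p; rewrite polyCN opprK /= polyC1.
Qed.

(** The difference of [x ^ m.+1] has leading term [m.+1 * x ^ m], whose coefficient is invertible in
    characteristic zero; the top term of [a] is removed in this way and the degree drops. *)
Lemma shift_poly_exact (a : {poly F}) :
  exists b : {poly F}, b \Po ('X + 1) - b = a.
Proof.
have [m] := ubnP (size a); elim: m => // m IHm in a *; rewrite ltnS => a_m.
case: m => [|m] in IHm a_m *.
  exists 0; rewrite comp_poly0 subr0; apply/esym/eqP.
  by rewrite -size_poly_eq0 -leqn0.
pose b : {poly F} := (a`_m / m.+1%:R) *: 'X^(m.+1).
have b_m : (size b <= m.+2)%N.
  by apply: leq_trans (size_scale_leq _ _) _; rewrite size_polyXn.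
have [|c cE] := IHm (a - (b \Po ('X + 1) - b)); last first.
  by exists (c + b); rewrite comp_polyD opprD addrACA cE subrK.
rewrite ltnS; apply/leq_sizeP => j; rewrite leq_eqVlt => /predU1P[<-|].
  rewrite !coefB; have [-> _] := coef_comp_shift b_m.
  rewrite /b !coefZ !coefXn eqxx ltn_eqF // mulr0 add0r mulr1 subr0.
  by rewrite mulrC divfK ?natr_neq0 // subrr.
rewrite leq_eqVlt => /predU1P[<-|m_j]; rewrite !coefB.
  have [_ ->] := coef_comp_shift b_m.
  by rewrite subrr subr0 (leq_sizeP _ _ a_m).
have /leq_sizeP a0 := a_m; have /leq_sizeP b0 := b_m.
have /leq_sizeP tb0 : (size (b \Po ('X + 1)) <= m.+2)%N.
  by rewrite -polyC1 size_comp_shift.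
by rewrite a0 ?b0 ?tb0 ?subrr // ltnW.
Qed.

(** With degree bound 0 a normal difference is a polynomial of size 0. The fraction [y / x] is
    normal because [deltaX] makes ['X] a permitted pole, so it cannot be exact unless [y = 0]. *)
Lemma shift_criterion :
    (forall u, dtx (difference shift_tau u) = difference shift_tau (dtx u)) ->
    (forall u, difference_normal never delta 0 u ->
       difference_normal never delta 0 (dtx u)) ->
  inexact_solution (difference shift_tau).
Proof.
move=> dtx_dx norm_dtx; have size_tau p : size (shift_tau p) = size p.
  exact: (size_comp_shift 1).
have special_tau p : irreducible_poly p -> never (shift_tau p) <-> never p.
  by [].
have delta_tau' p : irreducible_poly p -> ~ never p ->
    delta (shift_tau p) = delta p + 1 by move=> p_irr _; apply: delta_tau.
have norm_dx u : difference_normal never delta 0 (difference shift_tau u) ->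
    difference shift_tau u = 0.
  move=> /(difference_normal_poly tauK tauiK size_tau special_tau delta_eqp
    delta_tau')[a [->]].
  by rewrite leqn0 size_poly_eq0 => /eqP ->; rewrite tofrac0.
apply: (inexact_solution_iff (C := difference_normal never delta 0)
  (c := 'X%:F^-1)) => //.
- exact: coefficientwiseD dt_dtx.
- exact: coefficientwiseX dt_dtx.
- exact: coefficientwise_value0 dt_dtx.
- exact: differenceD tauK.
- by move=> a u; apply: (differenceZ tauK); rewrite /= comp_polyC.
- exact: difference_normalD.
- exact: difference_normalZ.
- apply: (difference_reduce tauK tauiK size_tau _ special_tau delta_eqp
    delta_tau') => // a.
  have [b bE] := shift_poly_exact a; exists b%:F.
  rewrite /difference fracmap_tofrac; last exact: can_inj tauK.
  rewrite -rmorphB /= bE subrr -tofrac0; split=> [|p p_irr _].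
    by apply: poly_degree_lt; rewrite size_poly0.
  exact: regular_at_poly.
- by move=> y; apply: coefficientwise_divX.
move=> y u yE; apply: cst_divX_eq0; rewrite yE; apply: norm_dx; rewrite -yE.
split=> [|p p_irr [//|p_bad]]; first exact: degree_lt_divX.
exists y%:P, 'X; split=> //; apply: ndvdp_polyX => // pX.
by rewrite (delta_eqp p_irr pX) deltaX eqxx in p_bad.
Qed.
End Shift.

Section Scale.
Variables (q : F) (delta : {poly F} -> int).
Hypotheses (q0 : q != 0) (q_ord : forall m, q ^+ m.+1 != 1)
  (delta_eqp : forall p a, irreducible_poly p -> p %= a -> delta p = delta a)
  (delta_tau : forall p, irreducible_poly p -> ~ p %= 'X ->
    delta (p \Po (q *: 'X)) = delta p + 1).

Definition scale_tau : {rmorphism {poly F} -> {poly F}} := comp_poly (q *: 'X).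
(** Since [q] is not a root of unity, [x] is up to constants the only irreducible polynomial that
    [x -> q x] fixes up to a constant. *)
Definition is_X (p : {poly F}) : Prop := p %= 'X.

Let tauK : cancel scale_tau (comp_poly (q^-1 *: 'X)) := comp_scaleK q0.
Let tauiK : cancel (comp_poly (q^-1 *: 'X)) scale_tau.
Proof.
by move=> p; have := comp_scaleK (invr_neq0 q0) p; rewrite invrK.
Qed.

Let normal := difference_normal is_X delta 1.

Lemma frac_scale_denom (c : F) (a d : {poly F}) : c != 0 -> d != 0 ->
  a%:F / (c *: d)%:F = (c^-1 *: a)%:F / d%:F.
Proof.
move=> cN0 dN0; apply/eqP.
rewrite eq_tofrac_div // -?size_poly_eq0 ?size_scale ?size_poly_eq0 //.
by rewrite -scalerAr -scalerAl scalerA divff // scale1r.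
Qed.

Lemma scale_normal_cst (a : F) : normal (cst a).
Proof.
split=> [|p p_irr _]; last exact: regular_at_poly.
by apply: poly_degree_lt; apply: size_polyC_leq1.
Qed.

(** [x ^ i] is an eigenvector of the difference with eigenvalue [q ^+ i - 1], nonzero for positive
    [i]; only the constant term is left over. *)
Lemma scale_reduce_poly (a : {poly F}) :
  exists v, normal (a%:F - difference scale_tau v).
Proof.
pose b := \poly_(i < size a) (a`_i / (q ^+ i - 1)); exists b%:F.
rewrite /difference fracmap_tofrac; last exact: can_inj tauK.
rewrite -!rmorphB /= (_ : _ - _ = (a`_0)%:P); first exact: scale_normal_cst.
apply/polyP => -[|i]; rewrite coefC !coefB coef_comp_scale /b coef_poly.
  by rewrite expr0 mul1r subrr subr0.
case: ltnP => [_|a_i]; last by rewrite (nth_default 0 a_i) mulr0 !subr0.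
rewrite -[X in _ - (_ - X)]mul1r -mulrBl mulrC divfK ?subrr //.
by rewrite subr_eq0 q_ord.
Qed.

(** The powers [x ^ - e.+1] are eigenvectors as well, with eigenvalue [q ^- e.+1 - 1]. The constant
    coefficient of [a] is thus removed by a difference, and the rest has a smaller power of [x]
    below. *)
Lemma scale_reduce_divX (a : {poly F}) e :
  exists v, normal (a%:F / ('X ^+ e)%:F - difference scale_tau v).
Proof.
have tau_inj := can_inj tauK; have dxD := differenceD tauK.
elim: e a => [|e IHe] a.
  by rewrite expr0 -tofrac_div1; apply: scale_reduce_poly.
have [c aE] : exists c : {poly F}, a = c * 'X + (a`_0)%:P.
  by elim/poly_ind: a => [|c k _]; [exists 0; rewrite coef0 mul0r add0r
    | exists c; rewrite coefD coefMX coefC add0r].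
have XeN0 : 'X^(e.+1) != 0 :> {poly F} by rewrite expf_neq0 ?polyX_eq0.
have qe1 : (q ^- e.+1 - 1) != 0.
  by rewrite subr_eq0 -invr1 (inj_eq invr_inj) q_ord.
pose k := a`_0 / (q ^- e.+1 - 1).
have kE : q ^- e.+1 * k - k = a`_0.
  by rewrite -[X in _ - X]mul1r -mulrBl mulrC divfK.
pose w : V := k%:P%:F / ('X^(e.+1))%:F.
have -> : a%:F / ('X ^+ e.+1)%:F = c%:F / ('X^e)%:F + difference scale_tau w.
  have -> : difference scale_tau w = (a`_0)%:P%:F / ('X^(e.+1))%:F.
    rewrite /difference /w fracmapE // rmorphXn /= comp_polyX comp_polyC exprZn.
    rewrite frac_scale_denom ?expf_neq0 ?polyX_eq0 // -mulrBl -rmorphB /=.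
    by rewrite -mul_polyC -polyCM -polyCB kE.
  rewrite addf_tofrac ?expf_neq0 ?polyX_eq0 //; apply/eqP.
  rewrite eq_tofrac_div ?mulf_neq0 ?expf_neq0 ?polyX_eq0 // {1}aE exprS.
  by apply/eqP; ring.
exact: (difference_reduce_exact tauK).
Qed.

(** With degree bound 1 a normal difference is a constant, and nonzero constants are not
    differences. The latter fact also shows that [c = 1] gives inexact functions. *)
Lemma scale_criterion :
    (forall u, dtx (difference scale_tau u) = difference scale_tau (dtx u)) ->
    (forall u, normal u -> normal (dtx u)) ->
  inexact_solution (difference scale_tau).
Proof.
move=> dtx_dx norm_dtx.
have size_tau p : size (scale_tau p) = size p by apply: size_comp_scale.
have special_eqp p a : p %= a -> is_X p -> is_X a.
  by rewrite /is_X => /eqp_ltrans ->.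
have tauX : scale_tau 'X %= 'X by rewrite /= comp_polyX eqp_scale.
have special_tau p : irreducible_poly p -> is_X (scale_tau p) <-> is_X p.
  rewrite /is_X.
  have -> : (scale_tau p %= 'X) = (scale_tau p %= scale_tau 'X).
    by rewrite ![scale_tau p %= _]eqp_sym (eqp_ltrans tauX).
  by rewrite /eqp !(dvdp_aut tauK tauiK).
apply: (inexact_solution_iff (C := normal) (c := 1)) => //.
- exact: coefficientwiseD dt_dtx.
- exact: coefficientwiseX dt_dtx.
- exact: coefficientwise_value0 dt_dtx.
- exact: differenceD tauK.
- by move=> a u; apply: (differenceZ tauK); rewrite /= comp_polyC.
- exact: difference_normalD.
- exact: difference_normalZ.
- move=> u /(difference_normal_poly tauK tauiK size_tau special_tau delta_eqp
    delta_tau)[a [uE /size1_polyC aE]].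
  have a0 : a`_0 = 0.
    by apply: (scale_difference_const (u := u) q0 q_ord); rewrite /cst -aE -uE.
  by rewrite uE aE a0 tofrac0.
- apply: (difference_reduce tauK tauiK size_tau special_eqp special_tau
    delta_eqp delta_tau scale_reduce_poly).
  move=> p a e _ /eqpf_eq[c cN0 ->].
  have -> : a%:F / ((c *: 'X) ^+ e)%:F = (c ^- e *: a)%:F / ('X ^+ e)%:F.
    by rewrite exprZn frac_scale_denom ?expf_neq0 ?polyX_eq0.
  exact: scale_reduce_divX.
- by move=> y; rewrite !mulr1 (coefficientwise_cst dt_dtx).
move=> y u; rewrite mulr1 => /esym; exact: scale_difference_const.
Qed.
End Scale.
End Criteria.

Lemma intr_eq0_pchar0 (F : fieldType) (i : int) : [pchar F] =i pred0 ->
  i%:~R = 0 :> F -> i = 0.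
Proof.
move=> char_F; case: i => [n|n] /eqP.
  by rewrite -pmulrn ((pcharf0P F).1 char_F) => /eqP ->.
by rewrite NegzE mulrNz oppr_eq0 -pmulrn (negPf (natr_neq0 char_F n)).
Qed.

Lemma iter_idfun (X : Type) m (w : X) : iter m idfun w = w.
Proof. by elim: m. Qed.

(** * Criteria for automorphisms and derivations of the coefficient field *)

Section CriteriaByOperator.
Variable F : fieldType.
Hypothesis char_F : [pchar F] =i pred0.

Section Automorphism.
Variables s si : {rmorphism F -> F}.
Hypotheses (sK : cancel s si) (siK : cancel si s).

Let mapK : cancel (map_poly s) (map_poly si) := map_polyK sK (rmorph0 si).
Let mapiK : cancel (map_poly si) (map_poly s) := map_polyK siK (rmorph0 s).
Let map_inj : injective (map_poly s) := can_inj mapK.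

Lemma automorphism_derivation_criterion (L : {poly F}) :
  (exists f, ~ (exists h, f = fracderiv h) /\
     exists g, apply_op (@cst F) (fracmap (map_poly s)) L f = fracderiv g)
  <-> exists y, y != 0 /\ apply_op id s L y = 0.
Proof.
apply: (derivation_criterion char_F (fracmap_coefficientwise s)) => u.
  exact: (fracmap_fracder_comm (D := @deriv F) (@derivM F) _ map_inj
    (fun a => esym (deriv_map s a))).
exact: (simple_poles_fracmap mapK mapiK (size_map_poly s)).
Qed.

Lemma fracmap_difference (tau : {rmorphism {poly F} -> {poly F}}) u :
    injective tau -> (forall p, map_poly s (tau p) = tau (map_poly s p)) ->
  fracmap (map_poly s) (difference tau u)
    = difference tau (fracmap (map_poly s) u).
Proof.
move=> tau_inj s_tau; rewrite /difference.
rewrite (fracmap_zmod_morphism map_inj) /=; congr (_ - _).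
exact: fracmap_comm.
Qed.

Lemma automorphism_shift_criterion (L : {poly F}) :
    (forall m n i w, iter m s w = iter n s w + i%:~R -> i = 0) ->
  (exists f, ~ (exists h, f = difference (shift_tau F) h) /\
     exists g, apply_op (@cst F) (fracmap (map_poly s)) L f
       = difference (shift_tau F) g)
  <-> exists y, y != 0 /\ apply_op id s L y = 0.
Proof.
move=> /(shift_location char_F)[delta [delta_eqp delta_tau delta_s deltaX]].
apply: (shift_criterion char_F (fracmap_coefficientwise s) delta_eqp delta_tau
  deltaX) => u.
  apply: fracmap_difference => [|p]; first exact: can_inj (comp_shiftK 1).
  by rewrite /= map_comp_poly rmorphD /= map_polyX rmorph1.
apply: (difference_normal_fracmap mapK mapiK (size_map_poly s)) => p p_irr.
by case=> // p_bad; right; rewrite -delta_s.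
Qed.

Lemma automorphism_scale_criterion (q : F) (L : {poly F}) :
    q != 0 -> (forall m, q ^+ m.+1 != 1) -> s q = q ->
    (forall m n i w, w != 0 -> iter m s w = q ^ i * iter n s w -> i = 0) ->
  (exists f, ~ (exists h, f = difference (scale_tau q) h) /\
     exists g, apply_op (@cst F) (fracmap (map_poly s)) L f
       = difference (scale_tau q) g)
  <-> exists y, y != 0 /\ apply_op id s L y = 0.
Proof.
move=> q0 q_ord sq /(scale_location q0 sq)[delta [delta_eqp delta_tau delta_s]].
apply: (scale_criterion (fracmap_coefficientwise s) q0 q_ord delta_eqp
  delta_tau) => u.
  apply: fracmap_difference => [|p]; first exact: can_inj (comp_scaleK q0).
  by rewrite /= map_comp_poly map_polyZ map_polyX sq.
apply: (difference_normal_fracmap mapK mapiK (size_map_poly s)) => p p_irr.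
have is_X_map : is_X (map_poly s p) -> is_X p.
  by rewrite /is_X -[X in _ %= X](map_polyX s) eqp_map.
case: (classic (is_X p)) => [pX|pX]; first by left.
by case=> [/is_X_map //|p_bad]; right; rewrite -delta_s.
Qed.

End Automorphism.

Section Derivation.
Variable D : {additive F -> F}.
Hypothesis DM : forall a b, D (a * b) = D a * b + a * D b.

Lemma fracder_difference (tau : {rmorphism {poly F} -> {poly F}}) u :
    injective tau -> (forall p, map_poly D (tau p) = tau (map_poly D p)) ->
  fracder (map_poly D) (difference tau u)
    = difference tau (fracder (map_poly D) u).
Proof.
move=> tau_inj D_tau; rewrite /difference.
rewrite (fracder_zmod_morphism (map_poly_derivM DM)) /=; congr (_ - _).
apply/esym/(fracmap_fracder_comm (map_poly_derivM DM)) => // p.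
exact: esym (D_tau p).
Qed.

Lemma derivation_shift_criterion (L : {poly F}) :
  (exists f, ~ (exists h, f = difference (shift_tau F) h) /\
     exists g, apply_op (@cst F) (fracder (map_poly D)) L f
       = difference (shift_tau F) g)
  <-> exists y, y != 0 /\ apply_op id D L y = 0.
Proof.
(* A derivation of the coefficients creates no new poles, so any orbit representatives are preserved
   and the identity serves as [s]. *)
have id_free m n i (w : F) : iter m idfun w = iter n idfun w + i%:~R -> i = 0.
  rewrite !iter_idfun => e; apply: (intr_eq0_pchar0 char_F).
  by apply: (addrI w); rewrite addr0 -e.
have [delta [delta_eqp delta_tau _ deltaX]] :=
  shift_location (s := idfun) char_F id_free.
apply: (shift_criterion char_F (fracder_coefficientwise DM) delta_eqp delta_tau
  deltaX) => u.
  apply: fracder_difference => [|p]; first exact: can_inj (comp_shiftK 1).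
  apply: (map_poly_deriv_comp DM).
  rewrite raddfD /= (map_poly_derivX DM) -polyC1 map_polyC /=.
  by rewrite (derivation1 DM) addr0.
exact: (difference_normal_fracder (map_poly_derivM DM) (size_map_poly_deriv D)).
Qed.

Lemma derivation_scale_criterion (q : F) (L : {poly F}) :
    q != 0 -> (forall i : int, q ^ i = 1 -> i = 0) -> D q = 0 ->
  (exists f, ~ (exists h, f = difference (scale_tau q) h) /\
     exists g, apply_op (@cst F) (fracder (map_poly D)) L f
       = difference (scale_tau q) g)
  <-> exists y, y != 0 /\ apply_op id D L y = 0.
Proof.
move=> q0 q_ord Dq.
have id_free m n i (w : F) : w != 0 ->
    iter m idfun w = q ^ i * iter n idfun w -> i = 0.
  move=> w0; rewrite !iter_idfun -{1}[w]mul1r => /(mulIf w0)/esym; exact: q_ord.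
have q_nat m : q ^+ m.+1 != 1 by apply/eqP => /(q_ord m.+1).
have [delta [delta_eqp delta_tau _]] :=
  scale_location (s := idfun) q0 erefl id_free.
apply: (scale_criterion (fracder_coefficientwise DM) q0 q_nat delta_eqp
  delta_tau) => u.
  apply: fracder_difference => [|p]; first exact: can_inj (comp_scaleK q0).
  apply: (map_poly_deriv_comp DM).
  rewrite -mul_polyC (map_poly_derivM DM) (map_poly_derivX DM) map_polyC /= Dq.
  by rewrite mul0r mulr0 addr0.
exact: (difference_normal_fracder (map_poly_derivM DM) (size_map_poly_deriv D)).
Qed.

End Derivation.
End CriteriaByOperator.

(** * The operators [S_t], [Q_t] and [D_t] on [k(t)] *)

Section RationalCoefficients.
Variables (k : fieldType) (q : k).
Hypotheses (char_k : [pchar k] =i pred0) (q0 : q != 0)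
  (q_ord : forall i : int, i != 0 -> q ^ i != 1).
Local Notation K := {fraction {poly k}}.

Definition cst_rmorph : {rmorphism k -> K} := @FracField.tofrac _ \o polyC.

Lemma char_K : [pchar K] =i pred0.
Proof. by move=> p; rewrite (fmorph_pchar cst_rmorph). Qed.

Lemma q_expz_eq1 (i : int) : q ^ i = 1 -> i = 0.
Proof. by move=> qi; apply/eqP; apply: contraT => /q_ord; rewrite qi eqxx. Qed.

Lemma cst_t_neq0 : cst_t q != 0.
Proof. by rewrite (fmorph_eq0 cst_rmorph). Qed.

Lemma cst_t_expz_eq1 (i : int) : cst_t q ^ i = 1 -> i = 0.
Proof.
move=> qi; apply: q_expz_eq1; apply: (fmorph_inj cst_rmorph).
by rewrite fmorphXz rmorph1.
Qed.

Lemma cst_t_expn_neq1 m : cst_t q ^+ m.+1 != 1.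
Proof. by apply/eqP => /(cst_t_expz_eq1 (i := m.+1)). Qed.

Definition act_St : {rmorphism K -> K} :=
  fracmap_rmorph (can_inj (@comp_shiftK k 1)).

Definition act_St_inv : {rmorphism K -> K} :=
  fracmap_rmorph (can_inj (@comp_shiftK k (-1))).

Definition act_Qt : {rmorphism K -> K} :=
  fracmap_rmorph (can_inj (comp_scaleK q0)).

Definition act_Qt_inv : {rmorphism K -> K} :=
  fracmap_rmorph (can_inj (comp_scaleK (invr_neq0 q0))).

Lemma act_StK : cancel act_St act_St_inv.
Proof.
move=> y; apply: (fracmapK (s1 := comp_poly ('X + 1%:P))
  (s2 := comp_poly ('X + (-1)%:P))); last exact: can_inj (comp_shiftK (-1)).
by move=> p; rewrite polyCN; apply: comp_shiftK.
Qed.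

Lemma act_St_invK : cancel act_St_inv act_St.
Proof.
move=> y; apply: (fracmapK (s1 := comp_poly ('X + (-1)%:P))
  (s2 := comp_poly ('X + 1%:P))); last exact: can_inj (comp_shiftK 1).
by move=> p; have := comp_shiftK (-1) p; rewrite [in 'X - _]polyCN opprK.
Qed.

Lemma act_QtK : cancel act_Qt act_Qt_inv.
Proof.
move=> y; apply: (fracmapK (s1 := comp_poly (q *: 'X))
  (s2 := comp_poly (q^-1 *: 'X))); first exact: comp_scaleK.
exact: can_inj (comp_scaleK (invr_neq0 q0)).
Qed.

Lemma act_Qt_invK : cancel act_Qt_inv act_Qt.
Proof.
move=> y; apply: (fracmapK (s1 := comp_poly (q^-1 *: 'X))
  (s2 := comp_poly (q *: 'X))); last exact: can_inj (comp_scaleK q0).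
by move=> p; have := comp_scaleK (invr_neq0 q0) p; rewrite invrK.
Qed.

(* [c] is the leading coefficient of [u] at infinity. *)
Definition lead_value (u : K) c := exists n d : {poly k},
  [/\ d != 0, u = n%:F / d%:F & c = lead_coef n / lead_coef d].

Lemma lead_value_inj u c e : lead_value u c -> lead_value u e -> c = e.
Proof.
move=> [n [d [dN0 -> ->]]] [n' [d' [d'N0 /eqP]]].
rewrite eq_tofrac_div // => /eqP ne ->; apply/eqP.
by rewrite eqr_div ?lead_coef_eq0 // -!lead_coefM ne.
Qed.

Lemma lead_value_St u c : lead_value u c -> lead_value (act_St u) c.
Proof.
move=> [n [d [dN0 -> ->]]].
exists (n \Po ('X + 1%:P)), (d \Po ('X + 1%:P)).
rewrite -size_poly_eq0 size_comp_shift size_poly_eq0; split=> //.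
  exact: (fracmapE (s := comp_poly ('X + 1%:P)) _ (can_inj (comp_shiftK 1))).
rewrite !lead_coef_comp ?size_XaddC // lead_coefDl ?size_polyX ?size_polyC //.
  by rewrite lead_coefX !expr1n !mulr1.
by case: (_ == _).
Qed.

Lemma lead_value_cstM a u c : lead_value u c ->
  lead_value (cst_rmorph a * u) (a * c).
Proof.
move=> [n [d [dN0 -> ->]]]; exists (a%:P * n), d; split=> //.
  by rewrite rmorphM mulrA.
by rewrite lead_coefM lead_coefC mulrA.
Qed.

(** The shift preserves the leading coefficient at infinity, whereas multiplication by [q ^ i]
    scales it by [q ^ i]; this coefficient is nonzero, so [q ^ i = 1]. *)
Lemma act_St_free m n i w : w != 0 ->
  iter m act_St w = cst_t q ^ i * iter n act_St w -> i = 0.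
Proof.
have iter_lead j u c : lead_value u c -> lead_value (iter j act_St u) c.
  by move=> uc; elim: j => //= j; apply: lead_value_St.
have [a [d [dN0 ->]]] := fracP w => w0 e; apply: q_expz_eq1.
have wc : lead_value (a%:F / d%:F) (lead_coef a / lead_coef d) by exists a, d.
have aN0 : a != 0 by apply: contra_neq w0 => ->; rewrite tofrac0 mul0r.
have cN0 : lead_coef a / lead_coef d != 0.
  by rewrite mulf_neq0 ?invr_eq0 ?lead_coef_eq0.
have := iter_lead m _ _ wc; rewrite e (_ : cst_t q = cst_rmorph q) //.
rewrite -fmorphXz.
move/lead_value_inj/(_ (lead_value_cstM _ (iter_lead n _ _ wc))).
by rewrite -{1}[X in X = _]mul1r => /(mulIf cN0)/esym.
Qed.

(** Both iterates differ from [w] by a [q]-difference in [t], by telescoping. The integer [i] is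
    then a constant that is a [q]-difference, hence 0. *)
Lemma act_Qt_free m n i w :
  iter m act_Qt w = iter n act_Qt w + i%:~R -> i = 0.
Proof.
have telescope j : exists z, iter j act_Qt w - w = act_Qt z - z.
  elim: j => [|j [z zE]]; first by exists 0; rewrite rmorph0 !subrr.
  exists (iter j act_Qt w + z); rewrite rmorphD /= opprD addrACA -zE.
  by rewrite addrA subrK.
have [[z zE] [z' z'E]] := (telescope m, telescope n) => e.
apply: (intr_eq0_pchar0 char_k).
apply: (scale_difference_const (u := z - z') q0).
  by move=> j; apply/eqP => /(q_expz_eq1 (i := j.+1)).
have -> : cst (i%:~R : k) = i%:~R :> K by apply: (rmorph_int cst_rmorph).
have e' : i%:~R = iter m act_Qt w - iter n act_Qt w by rewrite e addrC addKr.
rewrite e' -[LHS]/(act_Qt (z - z') - (z - z')) rmorphB opprD addrACA.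
by rewrite -opprD -zE -z'E opprD addrACA subrr addr0.
Qed.

Definition act_Dt : {additive K -> K} :=
  fracder_additive (D := @deriv k) (@derivM k).

Lemma act_DtM (a b : K) : act_Dt (a * b) = act_Dt a * b + a * act_Dt b.
Proof. exact: (fracderM (D := @deriv k) (@derivM k)). Qed.

End RationalCoefficients.

(** * Transfer to the operators of the theorem *)

Lemma apply_txE (k : fieldType) (q : k) dt (L : op_t k) (f : ktx k) :
  apply_tx q dt L f = apply_op (@cst (kt k)) (act_tx q dt) L f.
Proof. exact: eq_bigr. Qed.

Lemma apply_tE (k : fieldType) (q : k) dt (L : op_t k) (y : kt k) :
  apply_t q dt L y = apply_op id (act_t q dt) L y.
Proof. exact: eq_bigr. Qed.

(** The three equations allow each operator to be replaced by the morphism or derivation used in the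
    criteria, with which it agrees by computation. *)
Lemma operator_criterion (k : fieldType) (q : k) dt dx (L : op_t k)
    (dt' : kt k -> kt k) (dtx' dx' : ktx k -> ktx k) :
    act_t q dt = dt' -> act_tx q dt = dtx' -> act_x q dx = dx' ->
    ((exists f, ~ (exists h, f = dx' h) /\
       exists g, apply_op (@cst (kt k)) dtx' L f = dx' g)
     <-> exists y, y != 0 /\ apply_op id dt' L y = 0) ->
  (exists f : ktx k,
      ~ (exists h : ktx k, f = act_x q dx h) /\
      (exists g : ktx k, apply_tx q dt L f = act_x q dx g))
  <-> (exists y : kt k, y != 0 /\ apply_t q dt L y = 0).
Proof.
move=> <- <- <- [H1 H2]; split=> [[f [f_inexact [g Lf]]]|[y [y0 Ly]]].
  have [|y [y0 Ly]] := H1; last by exists y; split=> //; rewrite apply_tE.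
  exists f; split=> //; exists g.
  exact: etrans (esym (apply_txE q dt L f)) Lf.
have [|f [f_inexact [g Lf]]] := H2; first by exists y; rewrite -apply_tE.
by exists f; split=> //; exists g; exact: etrans (apply_txE q dt L f) Lf.
Qed.

Theorem theorem4p20 (k : closedFieldType) (char_k : [pchar k] =i pred0)
    (q : k) (q_neq0 : q != 0) (q_not_root1 : forall i : int, i != 0 -> q ^ i != 1)
    (dt : t_operator) (dx : x_operator) (dtx : mixed_pair dt dx)
    (L : op_t k) (L_neq0 : L != 0) :
  (exists f : ktx k,
      ~ (exists h : ktx k, f = act_x q dx h) /\
      (exists g : ktx k, apply_tx q dt L f = act_x q dx g))
  <-> (exists y : kt k, y != 0 /\ apply_t q dt L y = 0).
Proof.
have charK := char_K char_k; have qtN0 := cst_t_neq0 q_neq0.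
have q_ord := @cst_t_expz_eq1 k q q_not_root1.
have q_ordn := cst_t_expn_neq1 q_not_root1.
case: dtx; apply: operator_criterion (erefl _) (erefl _) (erefl _) _.
- exact: (derivation_shift_criterion charK (@act_DtM k) L).
- apply: (derivation_scale_criterion (@act_DtM k) L qtN0 q_ord).
  exact: etrans (fracder_tofrac (D := @deriv k) (@derivM k) _)
    (congr1 _ (derivC q)).
- exact: (automorphism_derivation_criterion charK (@act_StK k)
    (@act_St_invK k) L).
- apply: (automorphism_scale_criterion (@act_StK k) (@act_St_invK k) L qtN0
    q_ordn).
    apply: etrans (fracmap_tofrac (can_inj (@comp_shiftK k 1)) _) _.
    by rewrite /= comp_polyC.
  exact: act_St_free.
- exact: (automorphism_derivation_criterion charK (act_QtK q_neq0)
    (act_Qt_invK q_neq0) L).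
- apply: (automorphism_shift_criterion charK (act_QtK q_neq0)
    (act_Qt_invK q_neq0) L).
  exact: act_Qt_free.
Qed.
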